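(* Let $\Delta$ be a shellable simplicial complex with vertex set $\{x_1,\dots,x_n\}$ and with facets $F_1,\dots,F_m$, let $s_1,\dots,s_n$ be positive integers, let $K$ be a field, and let $R=K[x_1,\dots,x_n]$ and $R'=K[x_{11},\dots,x_{1s_1},\dots,x_{n1},\dots,x_{ns_n}]$ be polynomial rings over $K$. Then: (i) if $s_1,\dots,s_n>1$, then $\mathrm{reg}(R'/I_{\Delta^{(s_1,\dots,s_n)}})=\dim(\Delta)+1=\dim(R/I_\Delta)$; (ii) if for each $1\le i\le m$ we set $\lambda_i=|\{x_\ell\in F_i:\ s_\ell>1\}|$, then $$\mathrm{reg}(R'/I_{\Delta^{(s_1,\dots,s_n)}})\le \mathrm{reg}(R/I_\Delta)+\max\{\lambda_i:\ 1\le i\le m\}.$$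
   Context: Simplicial complexes are finite; $\mathcal{F}(\Delta)$ denotes the set of facets (maximal faces) of $\Delta$, and $[s]=\{1,\dots,s\}$. $\dim(\Delta)=\max\{|F|-1:F\in\Delta\}$, and $\dim(R/I_\Delta)$ is the Krull dimension. $I_\Delta$ denotes the Stanley-Reisner ideal of $\Delta$ (generated by the squarefree monomials of non-faces) in the polynomial ring over $K$ on the vertices of $\Delta$. Expansion: for a simplicial complex $\Delta$ with vertex set $\{x_1,\dots,x_n\}$ and positive integers $s_1,\dots,s_n$, the $(s_1,\dots,s_n)$-expansion $\Delta^{(s_1,\dots,s_n)}$ is the simplicial complex with vertex set $\{x_{11},\dots,x_{1s_1},x_{21},\dots,x_{2s_2},\dots,x_{n1},\dots,x_{ns_n}\}$ whose facets are exactly the sets $\{x_{i_1r_1},\dots,x_{i_kr_k}\}$ where $\{x_{i_1},\dots,x_{i_k}\}\in\mathcal{F}(\Delta)$ with $i_1<\cdots<i_k$ and $(r_1,\dots,r_k)\in[s_{i_1}]\times\cdots\times[s_{i_k}]$. Shellable (in the non-pure sense): $\Delta$ is shellable if there exists an ordering $F_1<\cdots<F_m$ of all the facets of $\Delta$ such that for any $i<j$ there exist a vertex $v\in F_j\setminus F_i$ and an index $\ell<j$ with $F_j\setminus F_\ell=\{v\}$. The Castelnuovo-Mumford regularity of a graded module $M$ over a standard graded polynomial ring is $\mathrm{reg}(M)=\max\{j-i:\beta_{i,j}(M)\neq0\}$, where $\beta_{i,j}(M)$ are the graded Betti numbers of $M$ over that ring ($R$ or $R'$ respectively). *)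

(* Defs.v *)
From HB Require Import structures.
From mathcomp Require Import boolp.
From mathcomp Require Import all_boot all_order all_algebra.
From mathcomp Require Import ring_quotient mpoly.

Set Implicit Arguments.
Unset Strict Implicit.
Unset Printing Implicit Defensive.

Import Order.TTheory GRing.Theory Num.Theory.
Local Open Scope ring_scope.

(* The field [face0] follows from the other two unless [V] is empty, where it
   excludes the void complex. *)
Record scomplex (V : finType) := SComplex {
  faces :> {set {set V}};
  face0 : set0 \in faces;
  face1 : forall v : V, [set v] \in faces;
  faceS : forall F G : {set V}, G \subset F -> F \in faces -> G \in faces }.

Section SimplicialComplexes.
Variable V : finType.
Implicit Type D : scomplex V.

Definition facets D : {set {set V}} := [set F : {set V} | maxset (mem D) F].

(* This is -1 when [D] is {emptyset}. *)
Definition complex_dim D : int := (\max_(F in faces D) #|F|)%N%:Z - 1.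

Definition shelling D (Fs : seq {set V}) : Prop :=
  [/\ uniq Fs, Fs =i facets D &
      forall i j : nat, (i < j < size Fs)%N ->
        exists v : V, exists2 l : nat, (l < j)%N &
          v \in nth set0 Fs j :\: nth set0 Fs i /\
          nth set0 Fs j :\: nth set0 Fs l = [set v]].

Definition shellable D : Prop := exists Fs, shelling D Fs.

Lemma sub_facet D F : F \in faces D -> exists2 G, G \in facets D & F \subset G.
Proof.
move=> FD; have [G maxG FG] := @maxset_exists _ (mem D) F FD.
by exists G; rewrite // inE.
Qed.

Lemma facet_face D F : F \in facets D -> F \in faces D.
Proof. by rewrite inE => /maxsetp. Qed.

Lemma facets_inP D G :
  reflect (G \in faces D /\
           forall H, H \in faces D -> G \subset H -> H = G) (G \in facets D).
Proof. by rewrite inE; apply: maxsetP. Qed.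

End SimplicialComplexes.

Section Expansion.
Variables (V : finType) (D : scomplex V) (s : V -> nat).

(* The vertex x_{v r} of the expansion is [Tagged _ r : {v : V & 'I_(s v)}]. *)
Definition lift_face (r : {dffun forall v : V, 'I_(s v)}) (F : {set V}) :
    {set {v : V & 'I_(s v)}} :=
  [set Tagged (fun v => 'I_(s v)) (r v) | v in F].

Definition expansion_facets : {set {set {v : V & 'I_(s v)}}} :=
  [set lift_face r F | r in [set: {dffun forall v : V, 'I_(s v)}],
                       F in facets D].

Definition expansion_faces : {set {set {v : V & 'I_(s v)}}} :=
  [set G : {set {v : V & 'I_(s v)}}
     | [exists H in expansion_facets, G \subset H]].

Hypothesis s_gt0 : forall v, (0 < s v)%N.

Lemma expansion_face0 : set0 \in expansion_faces.
Proof.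
have [F FD _] := sub_facet (face0 D).
rewrite inE; apply/exists_inP.
exists (lift_face [ffun v => Ordinal (s_gt0 v)] F); last exact: sub0set.
by apply/imset2P; exists [ffun v => Ordinal (s_gt0 v)] F; rewrite ?in_setT.
Qed.

Lemma expansion_face1 w : [set w] \in expansion_faces.
Proof.
case: w => v k; have [F FD vF] := sub_facet (face1 D v).
pose r : {dffun forall v : V, 'I_(s v)} :=
  [ffun u => dfwith (fun u => Ordinal (s_gt0 u)) k u].
rewrite inE; apply/exists_inP; exists (lift_face r F).
  by apply/imset2P; exists r F; rewrite ?in_setT.
rewrite sub1set; apply/imsetP; exists v; first by rewrite -sub1set.
by rewrite /r ffunE dfwith_in.
Qed.

Lemma expansion_faceS (F G : {set {v : V & 'I_(s v)}}) :
  G \subset F -> F \in expansion_faces -> G \in expansion_faces.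
Proof.
move=> GF; rewrite !inE => /exists_inP[H HD FH].
by apply/exists_inP; exists H; rewrite // (subset_trans GF).
Qed.

Definition expansion : scomplex {v : V & 'I_(s v)} :=
  SComplex expansion_face0 expansion_face1 expansion_faceS.

Lemma facets_expansion : facets expansion = expansion_facets.
Proof.
have tagK r (F : {set V}) : [set tag w | w in lift_face r F] = F.
  apply/setP=> v; apply/imsetP/idP => [[w /imsetP[u uF ->] ->] // | vF].
  by exists (Tagged (fun v => 'I_(s v)) (r v)) => //; apply/imsetP; exists v.
have cardL r (F : {set V}) : #|lift_face r F| = #|F|.
  by apply: card_in_imset => u v _ _ /(congr1 tag).
apply/setP=> G; apply/facets_inP/idP => [[GE maxG] | GE].
  move: GE; rewrite inE => /exists_inP[H HE GH].
  rewrite -(maxG H) // inE; apply/exists_inP; by exists H.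
split; first by rewrite inE; apply/exists_inP; exists G.
move=> H; rewrite inE => /exists_inP[L LE HL] GH.
suff GL : G = L by apply/eqP; rewrite eqEsubset GH GL HL.
have {GH HL} GL := subset_trans GH HL.
move: GE LE GL => /imset2P[r F _ FD ->] /imset2P[r' F' _ F'D ->] GL.
have FF' : F \subset F' by rewrite -(tagK r F) -(tagK r' F'); exact: imsetS.
have /facets_inP[_ maxF] := FD.
have eqF := maxF _ (facet_face F'D) FF'.
by apply/eqP; rewrite eqEcard GL !cardL eqF leqnn.
Qed.

End Expansion.

Definition choice_of (T : Type) (x0 : T) (P : T -> Prop) : T :=
  if pselect (exists x, P x) is left exP then projT1 (cid exP) else x0.

(* This is 0 when [S] has no maximum. *)
Definition maxz (S : int -> Prop) : int :=
  choice_of 0 (fun r => S r /\ forall z, S z -> z <= r).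

Definition prime_chain (A : comNzRingType) (d : nat) : Prop :=
  exists P : 'I_d.+1 -> prime_idealr A,
    forall i j : 'I_d.+1, (i < j)%N ->
      {subset P i <= P j} /\ ~ {subset P j <= P i}.

Definition krull_dim (A : comNzRingType) : int :=
  maxz (fun z => exists2 d : nat, z = d%:Z & prime_chain A d).

Section Regularity.
Variables (K : fieldType) (N : nat).
Local Notation R := {mpoly K[N]}.

(* 0 is homogeneous of every degree; for [d < 0] there is nothing else. *)
Definition homogeneous (d : int) (p : R) : Prop :=
  forall m, m \in msupp p -> (mdeg m)%:Z = d.

Variable M : lmodType R.

(* A complex ... -> F_1 -> F_0 -> M where F_i is the free module of row vectors
   R^(rk i) whose k-th basis vector is in degree [deg i k]. The map from F_i.+1
   to F_i is v |-> v *m diff i, and [aug] lists the images in M of the basis of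
   F_0. *)
Record free_complex := FreeComplex {
  rk : nat -> nat;
  deg : forall i, 'I_(rk i) -> int;
  diff : forall i, 'M[R]_(rk i.+1, rk i);
  aug : 'I_(rk 0) -> M }.

Arguments deg f {i} _.
Arguments aug f _ : clear implicits.

Definition augment (C : free_complex) (v : 'rV[R]_(rk C 0)) : M :=
  \sum_k v 0 k *: aug C k.
Arguments augment C v : clear implicits.

(* [gr d x] means that x is a homogeneous element of degree d in M. *)
Variable gr : int -> M -> Prop.

Definition graded_complex (C : free_complex) : Prop :=
  (forall k, gr (deg C k) (aug C k)) /\
  (forall i k l, homogeneous (deg C k - deg C l) (diff C i k l)).

Definition exact_complex (C : free_complex) : Prop :=
  [/\ forall x : M, exists v, augment C v = x,
      forall v, augment C v = 0 <-> exists w, v = w *m diff C 0 &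
      forall i (v : 'rV_(rk C i.+1)),
        v *m diff C i = 0 <-> exists w, v = w *m diff C i.+1].

(* The image of each differential lies in (x_1, ..., x_N) F_i. *)
Definition minimal_complex (C : free_complex) : Prop :=
  forall i k l, (diff C i k l)@_0%MM = 0.

Definition minimal_graded_resolution (C : free_complex) : Prop :=
  [/\ graded_complex C, exact_complex C & minimal_complex C].

(* The number of summands R(-j) of F_i in a minimal graded free resolution,
   which does not depend on the resolution. *)
Definition betti (i : nat) (j : int) : nat :=
  choice_of 0%N (fun b => exists2 C, minimal_graded_resolution C &
                            b = #|[set k : 'I_(rk C i) | deg C k == j]|).

Definition regularity : int :=
  maxz (fun z => exists i j, betti i j <> 0%N /\ z = j - i%:Z).

End Regularity.

Section QuotientModule.
Variables (A : comNzRingType) (I : idealr A).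
Local Notation Q := {ideal_quot I}.
Local Open Scope quotient_scope.

Definition quot_scale (a : A) (x : Q) : Q := \pi_Q a * x.

Fact quot_scaleA a b x : quot_scale a (quot_scale b x) = quot_scale (a * b) x.
Proof. by rewrite /quot_scale mulrA -rmorphM. Qed.
Fact quot_scale1 : left_id 1 quot_scale.
Proof. by move=> x; rewrite /quot_scale rmorph1 mul1r. Qed.
Fact quot_scaleDr : right_distributive quot_scale +%R.
Proof. by move=> a x y; rewrite /quot_scale mulrDr. Qed.
Fact quot_scaleDl x : {morph quot_scale^~ x : a b / a + b}.
Proof. by move=> a b; rewrite /quot_scale rmorphD mulrDl. Qed.

HB.instance Definition _ := GRing.Zmodule_isLmodule.Build A Q
  quot_scaleA quot_scale1 quot_scaleDr quot_scaleDl.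

End QuotientModule.

Definition ideal_span (A : comNzRingType) (S : A -> Prop) (p : A) : Prop :=
  exists k (c g : 'I_k -> A), (forall i, S (g i)) /\ p = \sum_i c i * g i.

Section StanleyReisner.
Variables (K : fieldType) (V : finType) (D : scomplex V).

(* The polynomial ring on the vertices is {mpoly K[#|V|]}, and the variable of a
   vertex v is indexed by the rank of v in the enumeration of V. *)
Definition face_monomial (F : {set V}) : {mpoly K[#|V|]} :=
  \prod_(v in F) 'X_(enum_rank v).

Definition nonface_monomial (p : {mpoly K[#|V|]}) : Prop :=
  exists2 F : {set V}, F \notin faces D & p = face_monomial F.

Definition SR_ideal : {pred {mpoly K[#|V|]}} :=
  fun p => `[< ideal_span nonface_monomial p >].

Fact SR_ideal_closed : idealr_closed SR_ideal.
Proof.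
split.
- by apply/asboolP; exists 0%N, (fun=> 0), (fun=> 0); split=> [[]//|]; rewrite big_ord0.
- apply/asboolP => -[k [c [g [Sg E]]]].
  have: (1 : {mpoly K[#|V|]}).@[fun=> 0] = 0.
    rewrite E rmorph_sum big1 // => i _; rewrite rmorphM /=.
    have [F FD ->] := Sg i; rewrite rmorph_prod /=.
    case: (set_0Vmem F) => [F0 | [v vF]]; first by rewrite F0 face0 in FD.
    by rewrite (bigD1 v) //= mevalXU mul0r mulr0.
  by move/eqP; rewrite rmorph1 oner_eq0.
- move=> a u v /asboolP[k [c [g [Sg ->]]]] /asboolP[k' [c' [g' [Sg' ->]]]].
  apply/asboolP; exists (k + k')%N.
  exists (fun i => match split i with inl x => a * c x | inr y => c' y end).
  exists (fun i => match split i with inl x => g x | inr y => g' y end).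
  split=> [i|]; first by case: (split i).
  rewrite big_split_ord /= mulr_sumr; congr (_ + _); apply: eq_bigr => i _.
  - by rewrite -[lshift _ _]/(unsplit (inl i)) unsplitK mulrA.
  - by rewrite -[rshift _ _]/(unsplit (inr i)) unsplitK.
Qed.

HB.instance Definition _ := isIdealr.Build {mpoly K[#|V|]} SR_ideal
  SR_ideal_closed.

Definition SR_ring := {ideal_quot SR_ideal}.
HB.instance Definition _ := GRing.ComNzRing.on SR_ring.
HB.instance Definition _ := GRing.Lmodule.on SR_ring.

Definition SR_grading (d : int) (x : SR_ring) : Prop :=
  exists2 p : {mpoly K[#|V|]}, homogeneous d p & x = (\pi_SR_ring p)%qT.

Definition reg_SR : int := regularity SR_grading.

End StanleyReisner.

(* Main.v *)
Require Import Defs.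
From HB Require Import structures.
From mathcomp Require Import boolp.
From mathcomp Require Import all_boot all_order all_algebra.
From mathcomp Require Import ring_quotient mpoly ring zify.

Set Implicit Arguments.
Unset Strict Implicit.
Unset Printing Implicit Defensive.
Import Order.TTheory GRing.Theory Num.Theory.
Local Open Scope ring_scope.

(* For a shelling F_1, ..., F_m let R_j be the set of vertices v of F_j with
   F_j \ F_l = {v} for some l < j. The theorem follows from
   reg(K[D]) = max_j |R_j|. The expansion is shelled by ordering its facets by
   the underlying facet of D and then by the sum of the copy indices; a facet
   lying over F_j then has as its restriction set the lift of R_j together with
   the points whose copy index is positive, which has at most
   |R_j| + lambda_j elements and can be the whole facet when all s_i > 1.

   Dimension shifting along a minimal resolution identifies the generators in
   homological degree i and degree j with the Koszul homology H_i(x; K[D])_j,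
   which splits over monomials: for a monomial m the chains are the functions
   on the sets S of variables dividing m such that the support of m / x^S is a
   face. The faces added by F_j form the interval [R_j, F_j], whose contribution
   is acyclic or lies in degree j - i = |R_j|; this gives the upper bound.
   Conversely, F_j is a facet with full restriction set in the link of
   F_j \ R_j, so the cochain dual to it is a nonzero class there, and long exact
   sequences carry it to an induced subcomplex of D.

   For the Krull dimension, the variables outside a prime of K[D] form a face F,
   and a chain of primes longer than |F| would yield elements that violate an
   algebraic relation over K among any |F| + 1 polynomials in |F| variables. *)
(** * Koszul signs and cochains on subsets *)

Section KoszulSigns.
Variables (R : comNzRingType) (N : nat).
Implicit Types (S : {set 'I_N}) (u v : 'I_N).

Definition ksign v S : R := (-1) ^+ #|[set u in S | (u < v)%N]|.

Lemma ksign_sqr v S : ksign v S * ksign v S = 1.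
Proof. by rewrite -expr2 sqrr_sign. Qed.

Lemma ksign_setU1 u v S :
  v \notin S -> ksign u (v |: S) = (-1) ^+ (v < u)%N * ksign u S.
Proof.
move=> vS; rewrite /ksign; case: ltnP => uv /=; last first.
  rewrite expr0 mul1r; congr (_ ^+ #|pred_of_set _|); apply/setP=> w.
  by rewrite !inE; case: eqP => // ->; rewrite (negbTE vS) ltnNge uv.
rewrite -exprD; congr (_ ^+ _); rewrite -[RHS](_ : #|v |: [set w in S | (w < u)%N]| = _).
  apply: eq_card => w; rewrite !inE andb_orl.
  by case: eqP => // ->; rewrite uv.
by rewrite cardsU1 inE (negbTE vS).
Qed.

Lemma ksignC u v S : u != v -> u \notin S -> v \notin S ->
  ksign v S * ksign u (v |: S) = - (ksign u S * ksign v (u |: S)).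
Proof.
move=> uv uS vS; rewrite !ksign_setU1 // -val_eqE /= in uv *.
by case: ltngtP uv => //= _ _; rewrite ?expr1 ?expr0; ring.
Qed.

Lemma ksign_swap u v S : u != v -> u \notin S -> v \notin S ->
  ksign u (v |: S) * ksign v (u |: S) = - (ksign v S * ksign u S).
Proof.
move=> uv uS vS; have e := ksignC uv uS vS.
have e1 := ksign_sqr v S; have e2 := ksign_sqr v (u |: S).
rewrite -[LHS]mul1r -e1 mulrACA mulrA e.
rewrite !mulNr -!mulrA.
by rewrite [ksign v (u |: S) * _]mulrCA e2 mulr1 [ksign u S * _]mulrC.
Qed.

End KoszulSigns.

(** The terms with v < u cancel against those with u < v. Splitting the sum this way avoids halving
    it, so the argument also works in characteristic 2. *)
Lemma antisym_sum0 (V : zmodType) N (P : pred 'I_N) (a : 'I_N -> 'I_N -> V) :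
    (forall u v, u != v -> P u -> P v -> a u v = - a v u) ->
  \sum_(u | P u) \sum_(v | P v && (v != u)) a u v = 0.
Proof.
move=> aC.
have -> : \sum_(u | P u) \sum_(v | P v && (v != u)) a u v =
  \sum_(u | P u) (\sum_(v | P v && (v < u)%N) a u v +
                  \sum_(v | P v && (u < v)%N) a u v).
  apply: eq_bigr => u Pu; rewrite (bigID (fun v : 'I_N => (v < u)%N)) /=.
  congr (_ + _); apply: eq_bigl => v; rewrite -val_eqE /=; case: (P v) => //=;
  by case: ltngtP.
rewrite big_split /= [X in _ + X](exchange_big_dep P) /=; last by move=> u v _ /andP[].
rewrite -big_split big1 //= => u Pu; apply/eqP; rewrite addr_eq0; apply/eqP.
rewrite -sumrN; apply: eq_big => [v|v /andP[Pv uv]]; first by rewrite Pu.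
by apply: aC => //; rewrite -val_eqE /= neq_ltn uv orbT.
Qed.

Section Coboundary.
Variables (K : fieldType) (N : nat).
Implicit Types (S W : {set 'I_N}) (u v : 'I_N) (c w : {set 'I_N} -> K).
Local Notation sg := (@ksign K N).

(** The Koszul boundary in coefficient form, [c S] being the coefficient of the exterior basis
    element e_S. In terms of complements in [W] it is the simplicial coboundary. *)
Definition cob W c S : K := \sum_(v in W :\: S) sg v S * c (v |: S).

Lemma cobB W c c' S : cob W (fun S => c S - c' S) S = cob W c S - cob W c' S.
Proof. by rewrite /cob -sumrB; apply: eq_bigr => v _; rewrite mulrBr. Qed.

Lemma cobD W c c' S : cob W (fun S => c S + c' S) S = cob W c S + cob W c' S.
Proof. by rewrite /cob -big_split; apply: eq_bigr => v _; rewrite mulrDr. Qed.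

Lemma eq_cob W c c' S :
  (forall u, u \in W :\: S -> c (u |: S) = c' (u |: S)) -> cob W c S = cob W c' S.
Proof. by move=> e; apply: eq_bigr => v vS; rewrite e. Qed.

Lemma cob_eq0 W c S :
  (forall u, u \in W :\: S -> c (u |: S) = 0) -> cob W c S = 0.
Proof. by move=> e; apply: big1 => v vS; rewrite e // mulr0. Qed.

Lemma cob_cob W c S : cob W (cob W c) S = 0.
Proof.
rewrite /cob -[RHS](@antisym_sum0 K N (fun u => u \in W :\: S)
  (fun u v => sg u S * (sg v (u |: S) * c (v |: (u |: S))))); last first.
  move=> u v uv; rewrite !inE => /andP[uS uW] /andP[vS vW].
  rewrite !mulrA -mulNr ksignC 1?eq_sym // setUCA.
  by rewrite mulNr.
apply: eq_bigr => u uP; rewrite mulr_sumr; apply: eq_bigl => v.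
by rewrite !inE negb_or; do ![case: (_ \in _) | case: (_ == _)].
Qed.

(** Exterior multiplication by e_v, a contracting homotopy for [cob]. *)
Definition cone v c S : K := if v \in S then sg v (S :\ v) * c (S :\ v) else 0.

Lemma cone_homotopy W v c S :
  v \in W -> cob W (cone v c) S + cone v (cob W c) S = c S.
Proof.
move=> vW; rewrite {2}/cone; case: ifPn => vS; last first.
  rewrite addr0 /cob (bigD1 v) ?inE ?vS //= big1 => [|u].
    by rewrite addr0 /cone setU11 setU1K // mulrA ksign_sqr mul1r.
  rewrite !inE => /andP[_ uv].
  by rewrite /cone !inE (negbTE vS) orbF eq_sym (negbTE uv) mulr0.
have [S' vS' SE] : exists2 S' : {set 'I_N}, v \notin S' & S = v |: S'.
  by exists (S :\ v); rewrite ?setD1K // !inE eqxx.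
rewrite {vS}SE setU1K // {2}/cob (bigD1 v) /=; last by rewrite !inE vS'.
rewrite mulrDr mulrA ksign_sqr mul1r addrCA -[RHS]addr0; congr (_ + _).
rewrite mulr_sumr /cob.
rewrite [X in _ + X](eq_bigl (fun u => u \in W :\: (v |: S'))); last first.
  by move=> u; rewrite !inE negb_or andbC andbA.
rewrite -big_split big1 //= => u; rewrite !inE negb_or => /andP[/andP[uv uS'] uW].
rewrite /cone !inE eqxx orbT.
have -> : (u |: (v |: S')) :\ v = u |: S'.
  apply/setP=> x; rewrite !inE; case: (eqVneq x v) => [->|] //=.
  by rewrite eq_sym (negbTE uv) (negbTE vS').
rewrite !mulrA -mulrDl ksign_swap //.
by rewrite addNr mul0r.
Qed.

(** On such an [X] the values of [cob W c] involve only the values of [c] on [X]. Functions on [X]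
    thus form a complex, whose exactness can be stated on [X] alone. *)
Definition upset W (X : {set {set 'I_N}}) :=
  forall S u, S \in X -> u \in W -> u |: S \in X.

(** The functions on [X] that vanish on [X'] form a relative complex. Toggling [v] preserves its
    index set, so [cone v] contracts it. *)
Lemma exact_free W (X X' : {set {set 'I_N}}) v c :
    v \in W -> upset W X -> upset W X' ->
    (forall S, S \in X :\: X' -> v |: S \in X :\: X' /\ S :\ v \in X :\: X') ->
    {in X, forall S, cob W c S = 0} -> {in X', forall S, c S = 0} ->
  exists w, {in X, forall S, cob W w S = c S}.
Proof.
move=> vW uX uX' free cX cX'.
(* Outside [X] the values of [c] are arbitrary and must be erased before the cone is taken. *)
pose c0 S := if S \in X :\: X' then c S else 0.
have c0E S : S \in X -> c0 S = c S.
  by move=> SX; rewrite /c0 inE SX andbT; case: (boolP (S \in X')) => //= /cX'.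
exists (cone v c0) => S SX; rewrite -c0E //.
have [SX'|SX'] := boolP (S \in X').
  rewrite c0E // cX' // cob_eq0 // => u; rewrite inE => /andP[_ uW].
  rewrite /cone; case: ifP => // vuS; rewrite /c0; case: ifP => [/free[+ _]|]; rewrite ?mulr0 //.
  by rewrite setD1K // inE uX'.
rewrite -[RHS](cone_homotopy c0 S vW) -[LHS]addr0; congr (_ + _).
rewrite /cone; case: ifP => // vS.
have /free[_] : S \in X :\: X' by rewrite inE SX'.
rewrite inE => /andP[_ SvX]; rewrite (@eq_cob W c0 c) ?cX ?mulr0 // => u.
by rewrite inE => /andP[_ uW]; rewrite c0E ?uX.
Qed.

Lemma cob_trunc W w p S :
  cob W (fun S => if #|S| == p.+1 then w S else 0) S =
  if #|S| == p then cob W w S else 0.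
Proof.
have cU u : u \in W :\: S -> #|u |: S| = #|S|.+1.
  by rewrite inE => /andP[uS _]; rewrite cardsU1 uS.
case: ifPn => pS; last by apply: cob_eq0 => u /cU->; rewrite eqSS (negbTE pS).
by apply: eq_cob => u /cU->; rewrite eqSS pS.
Qed.

End Coboundary.

(** * Shellings as lists of facets *)

Section FacetLists.
Variable V : finType.
Implicit Types (F G H T : {set V}) (s : seq {set V}).

Definition is_face s T := has (fun F => T \subset F) s.

Definition restriction s F :=
  [set v in F | has (fun H => F :\: H == [set v]) s].

(* The facets are listed in reverse shelling order. *)
Fixpoint rshelling s : Prop :=
  if s is F :: s' then
    (forall G, G \in s' -> exists2 v, v \in F :\: G & v \in restriction s' F) /\
    rshelling s'
  else True.

Fixpoint max_restriction s : nat :=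
  if s is F :: s' then maxn #|restriction s' F| (max_restriction s') else 0.

Definition antichain s := {in s &, forall F G, F \subset G -> F = G}.

Lemma restriction_sub s F : restriction s F \subset F.
Proof. by apply/subsetP=> v; rewrite inE => /andP[]. Qed.

Lemma is_faceS s T T' : T \subset T' -> is_face s T' -> is_face s T.
Proof. by move=> TT' /hasP[F Fs T'F]; apply/hasP; exists F; rewrite ?(subset_trans TT'). Qed.

(** A facet in [s] misses some vertex of the restriction set of [F]; conversely, for each v in that
    set, F \ v lies in a facet of [s]. So the new faces form the interval from the restriction set
    to [F]. *)
Lemma is_face_cons F s T : T \subset F -> rshelling (F :: s) ->
  is_face s T = ~~ (restriction s F \subset T).
Proof.
move=> TF [sh _]; apply/hasP/idP => [[G Gs TG]|].
  have [v] := sh G Gs; rewrite !inE => /andP[vG _] vr; apply: contraNN vG => rT.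
  by apply: (subsetP TG); apply: (subsetP rT); rewrite inE.
case/subsetPn => v; rewrite inE => /andP[vF /hasP[H Hs /eqP FH]] vT.
exists H => //; apply/subsetP=> x xT; apply: contraNT vT => xH.
have : x \in F :\: H by rewrite inE xH (subsetP TF).
by rewrite FH inE => /eqP <-.
Qed.

Lemma rshelling_notin F s : rshelling (F :: s) -> F \notin s.
Proof. by case=> sh _; apply/negP=> /sh[v]; rewrite setDv inE. Qed.

End FacetLists.

(** * Koszul homology in one multidegree: vanishing *)

Section KoszulFaces.
Variables (K : fieldType) (N : nat).
Implicit Types (F S T W : {set 'I_N}) (s : seq {set 'I_N}).
Implicit Types (m : 'X_{1..N}) (c w : {set 'I_N} -> K).

(* [S] indexes the multidegree [m] part of the Koszul complex; [quo_supp m S]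
   is the support of the monomial [x^m / x^S]. *)
Definition quo_supp m S := [set v | (v \in S) < m v]%N.
Definition mnm_supp m : {set 'I_N} := [set v | 0 < m v]%N.

Definition kfaces s m :=
  [set S : {set 'I_N} | (S \subset mnm_supp m) && is_face s (quo_supp m S)].

Lemma quo_suppS m S S' : S \subset S' -> quo_supp m S' \subset quo_supp m S.
Proof.
move=> SS'; apply/subsetP=> v; rewrite !inE; apply: leq_ltn_trans.
by case: (boolP (v \in S)) => // /(subsetP SS') ->.
Qed.

Lemma upset_kfaces s m : upset (mnm_supp m) (kfaces s m).
Proof.
move=> S u; rewrite !inE => /andP[Sm fS] um; rewrite subUset sub1set inE um Sm /=.
by apply: is_faceS fS; apply/quo_suppS/subsetUr.
Qed.

Lemma mdegE_set m S T : (forall v, m v = (v \in S) + (v \in T))%N ->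
  mdeg m = (#|S| + #|T|)%N.
Proof.
move=> mE; rewrite mdegE (eq_bigr _ (fun v _ => mE v)) big_split /=.
by congr addn; rewrite -sum1_card [RHS]big_mkcond; apply: eq_bigr => i _; case: (i \in _).
Qed.

(* The faces added by a facet [F] form the interval from [restriction s F] to
   [F]. In multidegree [m] their contribution is a cone over some variable,
   hence acyclic, unless it is a single [S], and then
   [mdeg m - #|S| = #|restriction s F|]. *)
Lemma kfaces_exact s m p c : rshelling s -> (max_restriction s + p < mdeg m)%N ->
    (forall S, #|S| != p -> c S = 0) ->
    {in kfaces s m, forall S, cob (mnm_supp m) c S = 0} ->
  exists w, {in kfaces s m, forall S, cob (mnm_supp m) w S = c S}.
Proof.
move=> + + cp; elim: s => [|F s IHs] sh deg cX.
  by exists (fun=> 0) => S; rewrite !inE andbF.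
set W := mnm_supp m in cX IHs *; set X := kfaces _ m in cX *; set X' := kfaces s m in IHs.
have XX' S : S \in X' -> S \in X by rewrite !inE => /andP[-> fS] /=; rewrite fS orbT.
have [w0 w0P] : exists w, {in X', forall S, cob W w S = c S}.
  apply: IHs => [|| S /XX' /cX//]; first by case: sh.
  by apply: leq_ltn_trans deg; rewrite leq_add2r leq_maxr.
(* Truncation keeps the corrected cochain [c'] in cardinality [p]. *)
pose w1 S := if #|S| == p.+1 then w0 S else 0.
pose c' S := c S - cob W w1 S.
have c'p S : #|S| != p -> c' S = 0.
  by move=> Sp; rewrite /c' cp // cob_trunc (negbTE Sp) subr0.
have c'X' : {in X', forall S, c' S = 0}.
  move=> S SX'; have [Sp|/c'p//] := eqVneq #|S| p.
  by rewrite /c' cob_trunc Sp eqxx w0P // subrr.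
have c'X : {in X, forall S, cob W c' S = 0}.
  by move=> S SX; rewrite cobB cX // cob_cob subr0.
suff [w2 w2P] : exists w, {in X, forall S, cob W w S = c' S}.
  by exists (fun S => w1 S + w2 S) => S SX; rewrite cobD w2P // addrC subrK.
have YE S : S \in X :\: X' =
    [&& S \subset W, quo_supp m S \subset F & restriction s F \subset quo_supp m S].
  rewrite !inE /=; case: (S \subset W) => //=.
  case: (boolP (quo_supp m S \subset F)) => qF /=; last by rewrite andNb.
  by rewrite (is_face_cons qF sh) negbK andbT.
(* Toggling such a [v] in S keeps [quo_supp m S] in the interval: if m v > 1 then [v] stays in the
   support anyway, and if [v] is outside the restriction set its presence is immaterial. *)
have [/existsP[v /and3P[vF v0 v1]]|/existsPn nv] := boolP [exists v,
    [&& v \in F, 0 < m v & (1 < m v) || (v \notin restriction s F)]]%N.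
  apply: (@exact_free _ _ W X X' v) => //; [by rewrite inE | exact: upset_kfaces..|].
  have key S S' : (forall x, x != v -> (x \in S') = (x \in S)) ->
      S \in X :\: X' -> S' \in X :\: X'.
    move=> SS'; rewrite !YE => /and3P[SW qF rq].
    apply/and3P; split; apply/subsetP=> x xP; have [xv|xv] := eqVneq x v.
    - by rewrite xv inE.
    - by apply: (subsetP SW); rewrite -SS'.
    - by rewrite xv.
    - by apply: (subsetP qF); move: xP; rewrite !inE SS'.
    - move: v1; rewrite -xv xP orbF => v1.
      by rewrite inE; apply: leq_ltn_trans v1; case: (_ \in _).
    - by move/(subsetP rq): xP; rewrite !inE SS'.
  by move=> S SY; split; apply: key SY => x xv; rewrite !inE (negbTE xv).
(* Without such a [v], a new S of cardinality [p] forces m to be x^S times x^R with R the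
   restriction set. Then m has degree p + |R|, against [deg]. *)
exists (fun=> 0) => S SX; rewrite cob_eq0 //.
have [SX'|SX'] := boolP (S \in X'); first by rewrite c'X'.
have [Sp|/c'p//] := eqVneq #|S| p.
have /and3P[SW qF rq] : [&& S \subset W, quo_supp m S \subset F &
    restriction s F \subset quo_supp m S] by rewrite -YE inE SX' SX.
have mE v : m v = ((v \in S) + (v \in restriction s F))%N.
  move: (subsetP SW v) (subsetP qF v) (subsetP rq v) (nv v).
  move: (subsetP (restriction_sub s F) v).
  have -> : (v \in W) = (0 < m v)%N by rewrite inE.
  have -> : (v \in quo_supp m S) = ((v \in S) < m v)%N by rewrite inE.
  case: (v \in restriction s F); case: (v \in S); case: (v \in F);
  case: (m v) => [|[|k]] //=; by [move=> /(_ isT) | move=> _ /(_ isT)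
    | move=> _ _ /(_ isT) | move=> _ _ _ /(_ isT)].
by move: deg; rewrite (mdegE_set mE) Sp addnC ltn_add2l /= ltnNge leq_maxl.
Qed.

End KoszulFaces.

(** * Nonvanishing cohomology of links and induced subcomplexes *)

Section NonVanishing.
Variables (K : fieldType) (N : nat).
Implicit Types (F G H S T W : {set 'I_N}) (s : seq {set 'I_N}).
Implicit Types (m : 'X_{1..N}) (c w : {set 'I_N} -> K).

(* Indexed by complements [S = W :\: T], these are the faces [T] of the
   restriction to [W] of the link of [G]. *)
Definition link_cofaces s G W :=
  [set S : {set 'I_N} | (S \subset W) && is_face s ((W :\: S) :|: G)].

(* The reduced cohomology of the restriction to [W] of the link of [G] does not
   vanish on faces with [k] vertices. *)
Definition link_nonvanishing s G W k := exists c,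
  [/\ forall S, c S != 0 -> S \subset W /\ (#|S| + k = #|W|)%N,
      {in link_cofaces s G W, forall S, cob W c S = 0} &
      ~ exists w, {in link_cofaces s G W, forall S, cob W w S = c S}].

Lemma upset_link_cofaces s G W : upset W (link_cofaces s G W).
Proof.
move=> S u; rewrite !inE => /andP[SW fS] uW; rewrite subUset sub1set uW SW /=.
by apply: is_faceS fS; apply/setSU/setDS/subsetUr.
Qed.

Lemma link_cofacesCE s G S :
  (S \in link_cofaces s G (~: G)) = (S \subset ~: G) && is_face s (~: S).
Proof.
rewrite inE; case: (boolP (S \subset _)) => //= SG; congr is_face.
apply/setP=> x; rewrite !inE; have := subsetP SG x; rewrite !inE.
by case: (x \in S); case: (x \in G) => //= /(_ isT).
Qed.

(** The coboundary of a cochain supported on facets is supported on strictly larger sets, none of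
    which is a face. *)
Lemma facet_cocycle s G c S :
    antichain s -> (forall S, c S != 0 -> ~: S \in s) ->
  S \in link_cofaces s G (~: G) -> cob (~: G) c S = 0.
Proof.
move=> anti cs; rewrite link_cofacesCE => /andP[_ /hasP[F Fs SF]].
apply: cob_eq0 => u; rewrite inE => /andP[uS _]; apply/eqP; apply: contraTT isT => /cs us.
have sub : ~: (u |: S) \subset F by rewrite (subset_trans _ SF) // setCS subsetUr.
have : u \in F by apply: (subsetP SF); rewrite inE.
by rewrite -(anti _ _ us Fs sub) !inE eqxx.
Qed.

(* The interval of faces added by a facet is acyclic unless it is reduced to the
   facet, so cohomology is spanned by cochains dual to facets. *)
Lemma link_cohomology s G c : rshelling s -> antichain s ->
    {in link_cofaces s G (~: G), forall S, cob (~: G) c S = 0} ->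
  exists w e, (forall S, e S != 0 -> ~: S \in s) /\
    {in link_cofaces s G (~: G), forall S, c S = cob (~: G) w S + e S}.
Proof.
elim: s => [|F s IHs] sh anti cX.
  by exists (fun=> 0), (fun=> 0); split=> S; rewrite ?eqxx // link_cofacesCE andbF.
set W := ~: G in cX IHs *; set X := link_cofaces _ _ _ in cX *.
set X' := link_cofaces _ _ _ in IHs.
have XX' S : S \in X' -> S \in X.
  by rewrite !inE => /andP[-> fS] /=; rewrite fS orbT.
have [w [e [es we]]] : exists w e, (forall S, e S != 0 -> ~: S \in s) /\
    {in X', forall S, c S = cob W w S + e S}.
  apply: IHs; first by case: sh.
    by move=> A B As Bs; apply: anti; rewrite inE ?As ?Bs orbT.
  by move=> S /XX'/cX.
have es' S : e S != 0 -> ~: S \in F :: s by move=> /es; rewrite inE orbC => ->.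
pose c' S := c S - (cob W w S + e S).
have c'X' : {in X', forall S, c' S = 0} by move=> S /we; rewrite /c' => ->; rewrite subrr.
have c'X : {in X, forall S, cob W c' S = 0}.
  move=> S SX; rewrite cobB cX // cobD cob_cob (facet_cocycle anti es') //.
  by rewrite addr0 subr0.
have YE S : S \in X :\: X' =
    [&& S \subset W, ~: S \subset F & restriction s F \subset ~: S].
  rewrite inE !link_cofacesCE -/W; case: (S \subset W) => //=.
  case: (boolP (~: S \subset F)) => SF /=; last by rewrite andNb.
  by rewrite (is_face_cons SF sh) negbK andbT.
have [/existsP[v /and3P[vF vr vG]]|/existsPn nv] := boolP [exists v,
    [&& v \in F, v \notin restriction s F & v \notin G]].
  have vW : v \in W by rewrite inE.
  have [||S SY|w' w'P] := exact_free vW _ _ _ c'X c'X'.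
  - exact: upset_link_cofaces.
  - exact: upset_link_cofaces.
  - move: SY; rewrite !YE => /and3P[SW SF rS]; split; apply/and3P; split.
    + by rewrite subUset sub1set vW.
    + by rewrite (subset_trans _ SF) // setCS subsetUr.
    + apply/subsetP=> x xr; rewrite !inE negb_or; move/(subsetP rS): (xr).
      by rewrite inE => ->; rewrite andbT; apply: contraNneq vr => <-.
    + by rewrite (subset_trans _ SW) // subD1set.
    + apply/subsetP=> x; rewrite !inE; case: eqVneq => [->|_] //= xS.
      by apply: (subsetP SF); rewrite inE.
    + by rewrite (subset_trans rS) // setCS subD1set.
  exists (fun S => w S + w' S), e; split=> // S SX.
  by rewrite cobD w'P // /c'; ring.
(* Every vertex of [F] now lies in [G] or in the restriction set, so [F] is the only new face
   containing [G]. The value of [c'] there is kept as a facet cochain. *)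
exists w, (fun S => e S + if S == ~: F then c' S else 0); split=> [S|S SX].
  rewrite inE; have [->|_] := eqVneq S (~: F); first by rewrite setCK eqxx.
  by rewrite addr0 => /es->; rewrite orbT.
case: eqVneq => [_|SF]; first by rewrite /c'; ring.
rewrite addr0; apply/eqP; rewrite -subr_eq0 -/(c' S); apply/eqP.
have [SX'|SX'] := boolP (S \in X'); first by rewrite c'X'.
have : S \in X :\: X' by rewrite inE SX' SX.
rewrite YE => /and3P[SW SF' rS]; case/eqP: SF.
apply/setP=> x; move: (introT implyP (subsetP SW x)) (introT implyP (subsetP SF' x)).
move: (introT implyP (subsetP rS x)) (nv x).
rewrite [x \in ~: F]inE [x \in ~: S]inE [x \in W]inE.
by case: (x \in S); case: (x \in F); case: (x \in restriction s F); case: (x \in G).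
Qed.

(** Suppose [w] has the cochain dual to [F] as coboundary. On the faces of [s] it is a cocycle,
    hence a coboundary [cob w1] plus facet cochains. The faces F \ u with u in the restriction set
    belong to [s] and are not facets, so at [F] the coboundary of [w] agrees with that of [cob w1],
    which is 0 and not 1. *)
Lemma facet_link_nonvanishing s1 F s : antichain (s1 ++ F :: s) ->
    rshelling (F :: s) -> let G := F :\: restriction s F in
  link_nonvanishing (s1 ++ F :: s) G (~: G) #|restriction s F|.
Proof.
move=> anti sh G; set s0 := s1 ++ F :: s in anti *.
have Fs0 : F \in s0 by rewrite mem_cat inE eqxx orbT.
have ss0 H : H \in s -> H \in s0 by move=> Hs; rewrite mem_cat inE Hs !orbT.
have GF : G \subset F by rewrite subsetDl.
pose c S : K := (S == ~: F)%:R.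
have cF S : c S != 0 -> S = ~: F.
  by rewrite /c; case: (eqVneq S) => //; rewrite eqxx.
exists c; split.
- move=> _ /cF ->; rewrite setCS; split=> //.
  have -> : ~: G = restriction s F :|: ~: F.
    apply/setP=> x; rewrite !inE; have := subsetP (restriction_sub s F) x.
    by rewrite !inE; case: (x \in F); case: (has _ _).
  rewrite cardsU disjoint_setI0 ?cards0 ?subn0 1?addnC //.
  by rewrite disjoints_subset setCK restriction_sub.
- by move=> S; apply: facet_cocycle => // ? /cF ->; rewrite setCK.
- case=> w wP.
  have antis : antichain s by move=> A B /ss0 As /ss0 Bs; apply: anti.
  have shs : rshelling s by case: sh.
  have wX : {in link_cofaces s G (~: G), forall S, cob (~: G) w S = 0}.
    move=> S; rewrite link_cofacesCE => /andP[SG fS].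
    have SX : S \in link_cofaces s0 G (~: G).
      by rewrite link_cofacesCE SG; case/hasP: fS => H /ss0 Hs SH; apply/hasP; exists H.
    rewrite wP //; apply/eqP; apply: contraTT isT => /cF SF.
    case/hasP: fS => H Hs; rewrite SF setCK => FH.
    by have := rshelling_notin sh; rewrite (anti _ _ Fs0 (ss0 _ Hs) FH) Hs.
  have [w1 [e [es w1e]]] := link_cohomology shs antis wX.
  have /wP : ~: F \in link_cofaces s0 G (~: G).
    rewrite link_cofacesCE setCK setCS GF; apply/hasP; by exists F.
  rewrite /c eqxx (@eq_cob _ _ _ _ (cob (~: G) w1)) ?cob_cob.
    by move/eqP; rewrite eq_sym oner_eq0.
  move=> u uP; have ur : u \in restriction s F.
    by move: uP; rewrite [u \in _]inE ![u \in ~: _]inE negbK inE; case: (u \in restriction s F);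
      case: (u \in F).
  have uF := subsetP (restriction_sub s F) u ur.
  rewrite w1e; last first.
    rewrite link_cofacesCE subUset sub1set setCS GF inE; apply/andP; split.
      by rewrite !inE; move: ur; rewrite inE => ->.
    move: ur; rewrite inE => /andP[_ /hasP[H Hs /eqP FH]]; apply/hasP; exists H => //.
    apply/subsetP=> x; rewrite setCU setCK !inE => /andP[xu xF].
    apply: contraNT xu => xH; have : x \in F :\: H by rewrite inE xH.
    by rewrite FH inE.
  suff -> : e (u |: ~: F) = 0 by rewrite addr0.
  apply/eqP; apply: contraTT isT => /es es'.
  have sub : ~: (u |: ~: F) \subset F by rewrite setCU setCK subsetIr.
  have := anti _ _ (ss0 _ es') Fs0 sub => /setP/(_ u).
  by rewrite !inE eqxx uF.
Qed.

(* Exactness in the middle of the long exact sequence relating the restriction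
   to [W] of the links of [G] and [v |: G] and the restriction to [v |: W] of
   the link of [G]. *)
Lemma link_nonvanishingU1 s G W v k : v \notin W ->
    link_nonvanishing s (v |: G) W k ->
  link_nonvanishing s G W k \/ link_nonvanishing s G (v |: W) k.+1.
Proof.
move=> vW [c [cS cX cN]].
have vU : v \in v |: W by rewrite setU11.
have XE S : S \subset W ->
    (S \in link_cofaces s (v |: G) W) = (S \in link_cofaces s G (v |: W)).
  move=> SW; rewrite !inE SW (subset_trans SW (subsetUr _ _)) /=; congr is_face.
  apply/setP=> x; rewrite !inE; case: (eqVneq x v) => [->|] //=.
  by rewrite (contra (subsetP SW v) vW) /= orbT.
have XvE S : S \subset W ->
    (v |: S \in link_cofaces s G (v |: W)) = (S \in link_cofaces s G W).
  move=> SW; rewrite !inE setUS // SW /=; congr is_face.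
  apply/setP=> x; rewrite !inE; case: (eqVneq x v) => [->|] //=.
  by rewrite (negbTE vW) andbF.
have c0 S : ~~ (S \subset W) -> c S = 0.
  by move=> SW; apply/eqP; apply: contraNT SW => /cS[].
have cdeg S : (#|S| + k != #|W|)%N -> c S = 0.
  by move=> SW; apply/eqP; apply: contraNT SW => /cS[_ ->].
have cobcE S : S \subset W -> cob (v |: W) c S = cob W c S.
  move=> SW; have vS := contra (subsetP SW v) vW.
  rewrite /cob (bigD1 v) /=; last by rewrite !inE vS eqxx.
  rewrite c0 ?mulr0 ?add0r; last by rewrite subUset sub1set (negbTE vW).
  by apply: eq_bigl => u; rewrite !inE; case: eqVneq => [->|] //=;
    rewrite ?andbT ?andbF ?(negbTE vW) ?andbF.
(* If the image of the class over [v |: W] is zero, a primitive [w] exists there, and its part on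
   sets containing [v] gives a class over [W]. *)
have [|nN] := pselect (link_nonvanishing s G (v |: W) k.+1); [by right|left].
have [w wX] : exists w, {in link_cofaces s G (v |: W), forall S, cob (v |: W) w S = c S}.
  apply: contrapT => nw; apply: nN; exists c; split=> // [S /cS[SW dS]|S SX].
    by rewrite (subset_trans SW (subsetUr _ _)) cardsU1 vW addnS dS add1n.
  have [vS|vS] := boolP (v \in S).
    rewrite cob_eq0 // => u _; rewrite c0 // subUset; apply/nandP; right.
    by apply: contra vW => /subsetP; apply.
  have SW : S \subset W.
    move: SX; rewrite inE => /andP[/subsetP SU _]; apply/subsetP=> x xS.
    by move: (SU x xS); rewrite !inE; case: eqVneq xS vS => [->->|].
  by rewrite cobcE // cX // XE.
pose e S := if (S \subset W) && (#|S| + k == #|W|)%N then ksign K v S * w (v |: S) else 0.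
exists e; split=> [S||[f fX]].
- by rewrite /e; case: ifP => [/andP[-> /eqP]|]; rewrite ?eqxx.
- move=> S SX; have SW : S \subset W by move: SX; rewrite inE => /andP[].
  have vS := contra (subsetP SW v) vW.
  have [dS|dS] := eqVneq (#|S|.+1 + k)%N #|W|; last first.
    rewrite cob_eq0 // => u; rewrite inE => /andP[uS _].
    by rewrite /e cardsU1 uS (negbTE dS) andbF.
  have := wX (v |: S); rewrite XvE // => /(_ SX).
  rewrite c0 ?subUset ?sub1set ?(negbTE vW) // => cob0.
  rewrite -[RHS](mulr0 (- ksign K v S)) -cob0 /cob mulr_sumr.
  rewrite [RHS](eq_bigl (fun u => u \in W :\: S)); last first.
    by move=> u; rewrite !inE negb_or; case: eqVneq => [->|] //=; rewrite (negbTE vW) andbF.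
  apply: eq_bigr => u; rewrite inE => /andP[uS uW].
  have uv : u != v by apply: contraNneq vW => <-.
  rewrite /e cardsU1 uS add1n dS eqxx subUset sub1set uW SW /=.
  by rewrite [v |: (u |: S)]setUCA !mulrA mulNr ksignC 1?eq_sym // opprK.
(* If [e] were the coboundary of [f], this correction would remove from [w] the terms on sets
   [v |: S] without changing [cob w], leaving a primitive of [c] over [W]. *)
apply: cN; pose w' S := w S + cob (v |: W) (cone v f) S.
have w'0 S : S \in link_cofaces s G W -> (#|S| + k = #|W|)%N -> w' (v |: S) = 0.
  move=> SX dS; have SW : S \subset W by move: SX; rewrite inE => /andP[].
  have vS := contra (subsetP SW v) vW.
  have h := cone_homotopy f (v |: S) vU.
  rewrite /w' -[cob _ _ _](addrK (cone v (cob (v |: W) f) (v |: S))) h.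
  rewrite /cone setU11 setU1K //.
  have -> : cob (v |: W) f S = ksign K v S * f (v |: S) + cob W f S.
    rewrite /cob (bigD1 v) /=; last by rewrite !inE vS eqxx.
    congr (_ + _); apply: eq_bigl => u; rewrite !inE; case: eqVneq => [->|] //=;
    by rewrite ?andbT ?andbF ?(negbTE vW) ?andbF.
  rewrite fX // /e SW dS eqxx /= mulrDr !mulrA ksign_sqr !mul1r; ring.
have cobw' S : cob (v |: W) w' S = cob (v |: W) w S by rewrite cobD cob_cob addr0.
have [kW|kW] := leqP k #|W|; last first.
  exists (fun=> 0) => S _; rewrite cob_eq0 // cdeg //.
  by apply: contraTneq kW => <-; rewrite -leqNgt leq_addl.
exists (fun S => if #|S| == (#|W| - k).+1 then w' S else 0) => S SX.
have SW : S \subset W by move: SX; rewrite inE => /andP[].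
have vS := contra (subsetP SW v) vW.
rewrite cob_trunc; have [dS|dS] := eqVneq #|S| (#|W| - k)%N; last first.
  by rewrite cdeg //; apply: contra dS => /eqP <-; rewrite addnK.
have {}dS : (#|S| + k = #|W|)%N by rewrite dS subnK.
have SX' : S \in link_cofaces s G (v |: W) by rewrite -XE.
rewrite -wX // -cobw' [RHS]/cob (bigD1 v) /=; last by rewrite !inE vS eqxx.
rewrite w'0 // ?mulr0 ?add0r; last first.
  by rewrite -XvE //; apply: upset_link_cofaces.
apply: eq_bigl => u; rewrite !inE; case: eqVneq => [->|] //=;
by rewrite ?andbT ?andbF ?(negbTE vW) ?andbF.
Qed.

(** The vertices of [G] are removed one by one, each being dropped or moved into [W]; the second
    case raises [k]. *)
Lemma link_nonvanishing_set0 s G W k : [disjoint G & W] ->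
    link_nonvanishing s G W k ->
  exists W' k', (k <= k')%N /\ link_nonvanishing s set0 W' k'.
Proof.
move En: #|G| => n; elim: n G W k En => [|n IHn] G W k.
  by move/eqP; rewrite cards_eq0 => /eqP -> _ h; exists W, k.
move=> Gn; have [->|[v vG]] := set_0Vmem G; first by move=> _ h; exists W, k.
rewrite -(setD1K vG); have vG' : v \notin G :\ v by rewrite !inE eqxx.
have cG : #|G :\ v| = n by apply/eqP; rewrite -eqSS -Gn (cardsD1 v G) vG.
rewrite disjoints_subset subUset sub1set inE -disjoints_subset => /andP[vW dGW].
case/(link_nonvanishingU1 vW) => [/(IHn _ _ _ cG dGW)//|].
have dGvW : [disjoint G :\ v & v |: W].
  rewrite disjoints_subset; apply/subsetP=> x xG; rewrite !inE negb_or.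
  move: dGW; rewrite disjoints_subset => /subsetP/(_ x xG); rewrite inE => ->.
  by rewrite andbT; apply: contraTneq xG => ->.
case/(IHn _ _ _ cG dGvW) => W' [k' [kk' h]]; exists W', k'; split=> //.
exact: ltnW.
Qed.

Lemma max_restriction_attained s : s != [::] ->
  exists s1 F s2, s = s1 ++ F :: s2 /\ #|restriction s2 F| = max_restriction s.
Proof.
elim: s => // F s IHs _; case: (leqP (max_restriction s) #|restriction s F|) => h.
  by exists [::], F, s; split=> //=; rewrite (maxn_idPl h).
have [|s1 [F' [s2 [sE rE]]]] := IHs; first by case: (s) h.
by exists (F :: s1), F', s2; split; rewrite /= ?sE // -sE rE (maxn_idPr (ltnW h)).
Qed.

Lemma rshelling_cat s1 s2 : rshelling (s1 ++ s2) -> rshelling s2.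
Proof. by elim: s1 => //= F s1 IHs [_ /IHs]. Qed.

Lemma mnm_supp_set W : mnm_supp (mesym1 W) = W.
Proof. by apply/setP=> v; rewrite !inE mnmE lt0b. Qed.

Lemma kfaces_set s W : kfaces s (mesym1 W) = link_cofaces s set0 W.
Proof.
apply/setP=> S; rewrite !inE mnm_supp_set setU0; congr (_ && is_face _ _).
by apply/setP=> v; rewrite !inE mnmE; case: (v \in S); case: (v \in W).
Qed.

(** Start from a facet with the largest restriction set. Passing to the empty link can only raise
    the degree, and [kfaces_exact] forbids a strict increase. *)
Lemma kfaces_nonexact s : rshelling s -> antichain s -> s != [::] ->
  exists W p c,
  [/\ (#|W| = max_restriction s + p)%N,
      forall S, c S != 0 -> S \subset W /\ #|S| = p,
      {in kfaces s (mesym1 W), forall S, cob W c S = 0} &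
      ~ exists w, {in kfaces s (mesym1 W), forall S, cob W w S = c S}].
Proof.
move=> sh anti /max_restriction_attained[s1 [F [s2 [sE rE]]]].
have sh2 : rshelling (F :: s2) by apply: (@rshelling_cat s1); rewrite -sE.
have anti' : antichain (s1 ++ F :: s2) by rewrite -sE.
have := facet_link_nonvanishing anti' sh2; rewrite /= -sE rE => nv.
have [|W [k [rk [c [cS cX cN]]]]] := link_nonvanishing_set0 _ nv.
  by rewrite disjoints_subset setCK.
have [kW|kW] := leqP k #|W|; last first.
  case: cN; exists (fun=> 0) => S _; rewrite cob_eq0 //; apply/esym/eqP.
  by apply: contraTT kW => /cS[_ <-]; rewrite -leqNgt leq_addl.
have [kr|kr] := leqP k (max_restriction s).
  have {kr rk} kE : k = max_restriction s by apply/eqP; rewrite eqn_leq kr.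
  exists W, (#|W| - k)%N, c; rewrite kfaces_set -kE subnKC //; split=> // S /cS[SW <-].
  by rewrite addnK.
case: cN; rewrite -kfaces_set in cX *.
have := @kfaces_exact K N s (mesym1 W) (#|W| - k) c sh.
rewrite mnm_supp_set; apply=> //.
  by rewrite mdeg_mesym1 -{2}(subnKC kW) ltn_add2r.
move=> S; apply: contraNeq => /cS[_ <-]; by rewrite addnK.
Qed.

End NonVanishing.

(** * The Koszul complex of the polynomial ring *)

Section KoszulPolynomials.
Variables (K : fieldType) (N : nat).
Local Notation R := {mpoly K[N]}.
Implicit Types (S W : {set 'I_N}) (u v : 'I_N) (q w : {set 'I_N} -> R).
Implicit Types (m : 'X_{1..N}) (P : pred {set 'I_N}) (s : seq {set 'I_N}).

(** The Koszul differential of x_1, ..., x_N over R, [q S] being the coefficient of e_S. *)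
Definition kpoly q S : R := \sum_(v | v \notin S) ksign R v S * 'X_v * q (v |: S).

Lemma mcoeffMXU (p : R) v m :
  (p * 'X_v)@_m = if (0 < m v)%N then p@_(m - U_(v))%MM else 0.
Proof.
case: ifPn => mv.
  rewrite -{1}(@submK _ U_(v)%MM m) 1?[(_ + U_(v))%MM]addmC ?mcoeffMX //.
  by apply/mnm_lepP=> u; rewrite mnm1E; case: eqVneq => [<-|].
apply: memN_msupp_eq0; rewrite (perm_mem (msuppMX _ _)).
by apply: contra mv => /mapP[m' _ ->]; rewrite mnmDE mnm1E eqxx.
Qed.

Lemma mnm_suppB m S : mnm_supp (m - mesym1 S) = quo_supp m S.
Proof. by apply/setP=> v; rewrite !inE mnmBE mnmE subn_gt0. Qed.

Lemma quo_suppD m S : quo_supp (m + mesym1 S) S = mnm_supp m.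
Proof. by apply/setP=> v; rewrite !inE mnmDE mnmE -{1}[(v \in S) : nat]add0n ltn_add2r. Qed.

Lemma sub_mnm_suppD m S : S \subset mnm_supp (m + mesym1 S).
Proof. by apply/subsetP=> v vS; rewrite inE mnmDE mnmE vS addn1. Qed.

Lemma mesym1U v S : v \notin S -> mesym1 (v |: S) = (U_(v) + mesym1 S)%MM.
Proof.
move=> vS; apply/mnmP=> u; rewrite mnmDE mnm1E !mnmE !inE eq_sym.
by case: eqVneq => [<-|]; rewrite ?(negbTE vS).
Qed.

(** The component in multidegree [m], where e_S itself has multidegree x^S. *)
Definition kcoef q m S : K :=
  if S \subset mnm_supp m then (q S)@_(m - mesym1 S)%MM else 0.

Lemma ksignE v S : ksign R v S = (ksign K v S)%:MP.
Proof.
rewrite /ksign -signr_odd -[in RHS]signr_odd.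
by case: odd; rewrite ?expr0 ?expr1 ?mpolyCN mpolyC1.
Qed.

Lemma kpoly_kcoef q m S : S \subset mnm_supp m ->
  (kpoly q S)@_(m - mesym1 S)%MM = cob (mnm_supp m) (kcoef q m) S.
Proof.
move=> Sm; rewrite raddf_sum /= /cob [RHS]big_mkcond [LHS]big_mkcond /=.
apply: eq_bigr => v _; rewrite !inE; case: (boolP (v \in S)) => //= vS.
rewrite -mulrA ['X_v * _]mulrC ksignE mcoeffCM mcoeffMXU mnmBE mnmE (negbTE vS) subn0.
case: ifP => mv; rewrite ?mulr0 //; congr (_ * _).
rewrite /kcoef subUset sub1set inE mv Sm /= mesym1U //.
by rewrite submDA addmC.
Qed.

(** The differential respects multidegrees, so primitives chosen in each of them glue together. *)
Lemma kpoly_assemble P q :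
    (forall m, exists w : {set 'I_N} -> K, forall S, S \subset mnm_supp m -> P (quo_supp m S) ->
       cob (mnm_supp m) w S = kcoef q m S) ->
  exists w, forall S m, P (mnm_supp m) -> (q S)@_m = (kpoly w S)@_m.
Proof.
(* [b] exceeds the degree of every term of [q], with e_S counted in degree |S|. Primitives in
   degrees from [b] on are replaced by 0, which makes the glued one polynomial. *)
move=> /choice[w wP]; pose b := (\max_S (msize (q S) + #|S|)).+1%N.
pose E S m := if (mdeg (m + mesym1 S)%MM < b)%N then w (m + mesym1 S)%MM S else 0.
pose w' S : R := \sum_(m : 'X_{1..N < b}) E S m *: 'X_[m].
have w'E S m : (w' S)@_m = E S m.
  have [mb|mb] := ltnP (mdeg m) b; first by rewrite mcoeff_mpoly.
  rewrite /E mdegD ltnNge (leq_trans mb) ?leq_addr //= raddf_sum big1 //= => i _.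
  rewrite mcoeffZ mcoeffX; case: eqP => [im|]; rewrite ?mulr0 //.
  by have := bmdeg i; rewrite im ltnNge mb.
exists w' => S m Pm; set M := (m + mesym1 S)%MM.
have mE : m = (M - mesym1 S)%MM by rewrite addmK.
have SM : S \subset mnm_supp M := sub_mnm_suppD m S.
rewrite {2}mE kpoly_kcoef //.
have kE S' : S' \subset mnm_supp M ->
    kcoef w' M S' = if (mdeg M < b)%N then w M S' else 0.
  move=> S'M; rewrite /kcoef S'M w'E /E submK //.
  apply/mnm_lepP=> v; rewrite mnmE; case: (boolP (v \in S')) => // /(subsetP S'M).
  by rewrite inE.
transitivity (if (mdeg M < b)%N then cob (mnm_supp M) (w M) S else 0); last first.
  case: ifPn => Mb; [apply: eq_cob | apply/esym/cob_eq0] => u; rewrite inE => /andP[_ uM];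
  by rewrite kE ?subUset ?sub1set ?uM ?SM // ?(negbTE Mb) ?Mb.
case: ifPn => Mb; first by rewrite wP ?quo_suppD // /kcoef SM -mE.
apply: memN_msupp_eq0; apply: msize_mdeg_ge; move: Mb; rewrite -leqNgt mdegD mdeg_mesym1.
move=> bm; rewrite -(leq_add2r #|S|); apply: leq_trans bm; rewrite /b.
apply: leqW; exact: (@leq_bigmax _ (fun S => msize (q S) + #|S|)%N).
Qed.

(** Acyclicity of the Koszul complex of R. In a multidegree m other than 1, toggling a variable that
    divides m is free on all squarefree divisors; the hypothesis on [q set0] settles m = 1. *)
Lemma kpoly_exact q : (forall S, kpoly q S = 0) -> (q set0)@_0%MM = 0 ->
  exists w, forall S, q S = kpoly w S.
Proof.
move=> dq q0; have [|w wP] := @kpoly_assemble xpredT q; last first.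
  by exists w => S; apply/mpolyP=> m; apply: wP.
move=> m; have [m0|[v vm]] := set_0Vmem (mnm_supp m).
  exists (fun=> 0) => S Sm _; have S0 : S = set0 by apply/eqP; rewrite -subset0 -m0.
  rewrite S0 m0 cob_eq0 => [|u]; last by rewrite !inE.
  rewrite /kcoef sub0set mesym1_set0 subm0; suff -> : m = 0%MM by rewrite q0.
  apply/mnmP=> v; rewrite mnm0E; apply/eqP; rewrite -leqn0 leqNgt.
  by move/setP/(_ v): m0; rewrite !inE => ->.
have uX : upset (mnm_supp m) (powerset (mnm_supp m)).
  by move=> S u; rewrite !inE subUset sub1set inE => -> ->.
have u0 : upset (mnm_supp m) set0 by move=> S u; rewrite inE.
have [S||S|w wP] := exact_free vm uX u0 _ _ _ (c := kcoef q m).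
- rewrite !inE /= => Sm; split; first by rewrite subUset sub1set vm.
  by rewrite (subset_trans (subD1set _ _)).
- by move=> S; rewrite inE => Sm; rewrite -kpoly_kcoef // dq mcoeff0.
- by rewrite inE.
by exists w => S Sm _; rewrite wP // inE.
Qed.

(** For [P] the faces of a complex, this is membership in its Stanley-Reisner ideal. *)
Definition vanishes_on P (p : R) := forall m, P (mnm_supp m) -> p@_m = 0.

Lemma vanishes_onB P p p' : vanishes_on P p -> vanishes_on P p' -> vanishes_on P (p - p').
Proof. by move=> a b m Pm; rewrite mcoeffB a // b // subrr. Qed.

Lemma kpoly_face_exact s p q : rshelling s ->
    (forall S, #|S| != p -> q S = 0) ->
    (forall S m, (q S)@_m != 0 -> (max_restriction s < mdeg m)%N) ->
    (forall S, vanishes_on (is_face s) (kpoly q S)) ->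
  exists w, forall S, vanishes_on (is_face s) (q S - kpoly w S).
Proof.
move=> sh qp qd dq; have [|w wP] := @kpoly_assemble (is_face s) q; last first.
  by exists w => S m Pm; rewrite mcoeffB (wP S m Pm) subrr.
move=> m; have [[S0 nz]|z] := pselect (exists S, kcoef q m S != 0); last first.
  exists (fun=> 0) => S Sm _; rewrite cob_eq0 //; apply/esym/eqP.
  by apply/negPn/negP => nz; apply: z; exists S.
have [||S|w wP] := @kfaces_exact K N s m p (kcoef q m) sh.
- move: nz; rewrite /kcoef; case: ifP => [S0m|]; rewrite ?eqxx // => nz.
  have <- : #|S0| = p by apply/eqP; apply: contraNT nz => /qp->; rewrite mcoeff0.
  have := qd _ _ nz; rewrite -(ltn_add2r #|S0|) => /leq_trans; apply.
  rewrite -(mdeg_mesym1 S0) -mdegD submK //.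
  apply/mnm_lepP=> v; rewrite mnmE; case: (boolP (v \in S0)) => // /(subsetP S0m).
  by rewrite inE.
- by move=> S /qp qS; rewrite /kcoef qS mcoeff0 if_same.
- rewrite inE => /andP[Sm fS]; rewrite -kpoly_kcoef //; apply: dq.
  by rewrite mnm_suppB.
by exists w => S Sm fS; rewrite wP // inE Sm.
Qed.

Lemma kpoly_face_nonexact s : rshelling s -> antichain s -> s != [::] ->
  exists p q,
  [/\ forall S, #|S| != p -> q S = 0,
      forall S m, (q S)@_m != 0 -> mdeg m = max_restriction s,
      forall S, vanishes_on (is_face s) (kpoly q S) &
      ~ exists w, forall S, vanishes_on (is_face s) (q S - kpoly w S)].
Proof.
move=> sh anti s0; have [W [p [c [Wp cS cX cN]]]] := kfaces_nonexact K sh anti s0.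
have subm S : S \subset W -> (mesym1 S <= mesym1 W)%MM.
  move=> SW; apply/mnm_lepP=> v; rewrite !mnmE.
  by case: (boolP (v \in S)) => // /(subsetP SW) ->.
(* The class [c] is placed in the single squarefree multidegree x^W. *)
pose q S : R := c S *: 'X_[(mesym1 W - mesym1 S)].
have qc S m : (q S)@_m != 0 -> c S != 0 /\ m = (mesym1 W - mesym1 S)%MM.
  rewrite mcoeffZ mcoeffX mulf_eq0 negb_or => /andP[-> ].
  by case: (eqVneq _ m) => [<-|] //=; rewrite eqxx.
have qE m S : kcoef q m S = if m == mesym1 W then c S else 0.
  rewrite /kcoef; have [->|mW] := eqVneq m (mesym1 W).
    rewrite mnm_supp_set; case: ifPn => SW; first by rewrite mcoeffZ mcoeffX eqxx mulr1.
    by apply/esym/eqP; apply: contraNT SW => /cS[].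
  case: ifP => // Sm; apply/eqP; apply: contraNT mW => /qc[/cS[SW _]] e.
  rewrite -(@submK _ (mesym1 S) m) ?e ?submK ?subm //.
  apply/mnm_lepP=> v; rewrite mnmE; case: (boolP (v \in S)) => // /(subsetP Sm).
  by rewrite inE.
exists p, q; split.
- move=> S Sp; suff -> : q S = 0 by [].
  rewrite /q; suff -> : c S = 0 by rewrite scale0r.
  by apply/eqP; apply: contraNT Sp => /cS[_ ->].
- move=> S m /qc[/cS[SW Sp] ->]; apply/eqP; rewrite -(eqn_add2r p) -Wp -{1}Sp.
  by rewrite -(mdeg_mesym1 S) -mdegD submK ?subm // mdeg_mesym1.
- move=> S m fm; rewrite -{1}(addmK (mesym1 S) m) kpoly_kcoef ?sub_mnm_suppD //.
  set M := (m + mesym1 S)%MM.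
  have [MW|MW] := eqVneq M (mesym1 W); last first.
    by rewrite cob_eq0 // => u _; rewrite qE (negbTE MW).
  rewrite (@eq_cob _ _ _ _ c) => [|u _]; last by rewrite qE MW eqxx.
  rewrite MW mnm_supp_set cX // inE -MW sub_mnm_suppD quo_suppD //.
case=> w wP; apply: cN; exists (kcoef w (mesym1 W)) => S.
rewrite inE mnm_supp_set => /andP[SW fS]; rewrite -{1}(mnm_supp_set W).
rewrite -kpoly_kcoef ?mnm_supp_set //; apply/eqP; rewrite -subr_eq0 -oppr_eq0 opprB.
have := wP S (mesym1 W - mesym1 S)%MM; rewrite mnm_suppB => /(_ fS).
rewrite mcoeffB mcoeffZ mcoeffX eqxx mulr1 => ->; exact: eqxx.
Qed.

End KoszulPolynomials.

(** * Graded free resolutions and Koszul homology *)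

Section HomogeneousParts.
Variables (K : fieldType) (N : nat).
Local Notation R := {mpoly K[N]}.
Implicit Types (z d : int) (p q : R) (m : 'X_{1..N}).

Definition homz z p : R :=
  \sum_(m <- msupp p | (mdeg m)%:Z == z) p@_m *: 'X_[m].

Lemma mcoeff_homz z p m :
  (homz z p)@_m = if (mdeg m)%:Z == z then p@_m else 0.
Proof.
rewrite /homz raddf_sum /=; case: ifPn => mz.
  have [mp|mp] := boolP (m \in msupp p).
    rewrite (big_rem m) //= mz mcoeffZ mcoeffX eqxx mulr1 big1_seq ?addr0 // => m'.
    rewrite rem_filter ?msupp_uniq // mem_filter => /and3P[_ /= mm' _].
    by rewrite mcoeffZ mcoeffX (negbTE mm') mulr0.
  rewrite (memN_msupp_eq0 mp) big1_seq // => m' /andP[_ m'p].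
  rewrite mcoeffZ mcoeffX; case: eqP => [mm'|]; rewrite ?mulr0 //.
  by rewrite -mm' m'p in mp.
rewrite big1 // => m' m'z; rewrite mcoeffZ mcoeffX; case: eqP => [mm'|]; rewrite ?mulr0 //.
by rewrite -mm' m'z in mz.
Qed.

Lemma homzD z p q : homz z (p + q) = homz z p + homz z q.
Proof. by apply/mpolyP=> m; rewrite !(mcoeffD, mcoeff_homz); case: ifP; rewrite ?addr0. Qed.

Lemma homz0 z : homz z 0 = 0.
Proof. by apply/mpolyP=> m; rewrite mcoeff_homz mcoeff0 if_same. Qed.

Lemma homz_sum (I : Type) (r : seq I) (P : pred I) (f : I -> R) z :
  homz z (\sum_(i <- r | P i) f i) = \sum_(i <- r | P i) homz z (f i).
Proof. exact: (big_morph _ (homzD z) (homz0 z)). Qed.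

Lemma homz_homogeneous z p : homogeneous z (homz z p).
Proof. by move=> m; rewrite mcoeff_msupp mcoeff_homz; case: ifP => [/eqP|_] //; rewrite eqxx. Qed.

Lemma homz_id z p : homogeneous z p -> homz z p = p.
Proof.
move=> hp; apply/mpolyP=> m; rewrite mcoeff_homz; case: ifPn => // mz.
apply/esym/memN_msupp_eq0; by apply: contra mz => /hp ->.
Qed.

Lemma homzK z p : homz z (homz z p) = homz z p.
Proof. exact/homz_id/homz_homogeneous. Qed.

Lemma homzM z d p a : homogeneous d a -> homz z (p * a) = homz (z - d) p * a.
Proof.
move=> ha; apply/mpolyP=> m; rewrite mcoeff_homz !mcoeffM; case: ifPn => mz.
  apply: eq_bigr => k /eqP mE; rewrite mcoeff_homz.
  have [a0|a0] := eqVneq a@_k.2 0; first by rewrite a0 !mulr0.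
  have := ha k.2; rewrite mcoeff_msupp => /(_ a0) <-.
  have e : mdeg m = (mdeg k.1 + mdeg k.2)%N by rewrite -mdegD -mE.
  suff -> : (mdeg k.1)%:Z == z - (mdeg k.2)%:Z by [].
  by clear -mz e; lia.
apply/esym/big1 => k /eqP mE; rewrite mcoeff_homz.
have [a0|a0] := eqVneq a@_k.2 0; first by rewrite a0 mulr0.
have := ha k.2; rewrite mcoeff_msupp => /(_ a0) dE.
have e : mdeg m = (mdeg k.1 + mdeg k.2)%N by rewrite -mdegD -mE.
suff /negbTE -> : (mdeg k.1)%:Z != z - d by rewrite mul0r.
by clear -mz e dE; lia.
Qed.

Lemma homogeneousX m : homogeneous (mdeg m)%:Z ('X_[m] : R).
Proof. by move=> m'; rewrite msuppX inE => /eqP ->. Qed.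

Lemma homogeneousM d d' p q :
  homogeneous d p -> homogeneous d' q -> homogeneous (d + d') (p * q).
Proof.
move=> hp hq; have <- : homz (d + d') (p * q) = p * q.
  by rewrite (homzM _ _ hq) addrK homz_id.
exact: homz_homogeneous.
Qed.

Lemma homogeneousC (c : K) : homogeneous 0 (c%:MP : R).
Proof. by move=> m; rewrite msuppC; case: ifP => // _; rewrite inE => /eqP ->; rewrite mdeg0. Qed.

Section Rows.
Variables (k : nat) (dg : 'I_k -> int).
Implicit Types (v : 'rV[R]_k).

Definition hrow z v : 'rV[R]_k := \row_i homz (z - dg i) (v 0 i).

Lemma hrowK z v : hrow z (hrow z v) = hrow z v.
Proof. by apply/rowP=> i; rewrite !mxE homzK. Qed.

Lemma hrowD z v v' : hrow z (v + v') = hrow z v + hrow z v'.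
Proof. by apply/rowP=> i; rewrite !mxE homzD. Qed.

Lemma hrow0 z : hrow z 0 = 0.
Proof. by apply/rowP=> i; rewrite !mxE homz0. Qed.

Lemma hrowZ z d a v : homogeneous d a -> hrow z (a *: v) = a *: hrow (z - d) v.
Proof.
move=> ha; apply/rowP=> i; rewrite !mxE mulrC (homzM _ _ ha) mulrC.
by congr (_ * homz _ _); rewrite addrAC.
Qed.

Lemma hrow_sum (I : Type) (r : seq I) (P : pred I) (f : I -> 'rV[R]_k) z :
  hrow z (\sum_(i <- r | P i) f i) = \sum_(i <- r | P i) hrow z (f i).
Proof. exact: (big_morph _ (hrowD z) (hrow0 z)). Qed.

End Rows.

Lemma hrow_mul k l (dg : 'I_k -> int) (dg' : 'I_l -> int) (A : 'M[R]_(k, l)) z v :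
    (forall a b, homogeneous (dg a - dg' b) (A a b)) ->
  hrow dg' z (v *m A) = hrow dg z v *m A.
Proof.
move=> hA; apply/rowP=> b; rewrite !mxE homz_sum; apply: eq_bigr => a _.
rewrite mxE (homzM _ _ (hA a b)); congr (homz _ _ * _); ring.
Qed.

End HomogeneousParts.

Section KoszulRows.
Variables (K : fieldType) (N : nat).
Local Notation R := {mpoly K[N]}.
Implicit Types (S : {set 'I_N}).

Definition kos k (y : {set 'I_N} -> 'rV[R]_k) S : 'rV[R]_k :=
  \sum_(v | v \notin S) (ksign R v S * 'X_v) *: y (v |: S).

Lemma kosE k y S (a : 'I_k) : kos y S 0 a = kpoly (fun S => y S 0 a) S.
Proof. by rewrite summxE; apply: eq_bigr => v _; rewrite mxE. Qed.

Lemma eq_kos k (y y' : {set 'I_N} -> 'rV[R]_k) S : y =1 y' -> kos y S = kos y' S.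
Proof. by move=> e; apply: eq_bigr => v _; rewrite e. Qed.

Lemma kosB k (y y' : {set 'I_N} -> 'rV[R]_k) S :
  kos (fun S => y S - y' S) S = kos y S - kos y' S.
Proof. by rewrite /kos -sumrB; apply: eq_bigr => v _; rewrite scalerBr. Qed.

Lemma kos_mul k l (A : 'M[R]_(k, l)) (y : {set 'I_N} -> 'rV[R]_k) S :
  kos (fun S => y S *m A) S = kos y S *m A.
Proof. by rewrite /kos mulmx_suml; apply: eq_bigr => v _; rewrite scalemxAl. Qed.

Lemma kos_kos k (y : {set 'I_N} -> 'rV[R]_k) S : kos (kos y) S = 0.
Proof.
rewrite /kos -[RHS](@antisym_sum0 _ N (fun u => u \notin S)
  (fun u v => (ksign R u S * 'X_u) *:
     ((ksign R v (u |: S) * 'X_v) *: y (v |: (u |: S))))); last first.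
  move=> u v uv uS vS; rewrite !scalerA -scaleNr setUCA; congr (_ *: _).
  rewrite [LHS]mulrACA [X in - X]mulrACA -mulNr [in RHS](mulrC 'X_v); congr (_ * _).
  by rewrite ksignC // eq_sym.
apply: eq_bigr => u uP; rewrite scaler_sumr; apply: eq_bigl => v.
by rewrite !inE negb_or andbC.
Qed.

Lemma kos_const k (y : {set 'I_N} -> 'rV[R]_k) S a : (kos y S 0 a)@_0%MM = 0.
Proof.
rewrite kosE /kpoly raddf_sum big1 //= => v _.
by rewrite mulrAC mcoeffMXU mnm0E.
Qed.

Lemma kos_exact k (y : {set 'I_N} -> 'rV[R]_k) :
    (forall S, kos y S = 0) -> (forall a, (y set0 0 a)@_0%MM = 0) ->
  exists w, forall S, y S = kos w S.
Proof.
move=> dy y0; have /choice[w wP] a : exists w, forall S, y S 0 a = kpoly w S.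
  by apply: (kpoly_exact (q := fun S => y S 0 a)) => // S; rewrite -kosE dy mxE.
exists (fun S => \row_a w a S) => S; apply/rowP=> a; rewrite kosE wP.
by apply: eq_bigr => v _; rewrite mxE.
Qed.

(** The projection to Koszul degree [p] and total degree [j]; e_S accounts for |S| = p of the
    latter. *)
Definition hkos k (dg : 'I_k -> int) p j (y : {set 'I_N} -> 'rV[R]_k) S :=
  if #|S| == p then hrow dg (j - p%:Z) (y S) else 0.

Lemma hkosK k (dg : 'I_k -> int) p j y S :
  hkos dg p j (hkos dg p j y) S = hkos dg p j y S.
Proof. by rewrite /hkos; case: ifP => // ->; rewrite hrowK. Qed.

Lemma homogeneous_sign v S : homogeneous 1 (ksign R v S * 'X_v).
Proof.
rewrite ksignE -[1 : int]add0r; apply: homogeneousM; first exact: homogeneousC.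
by have := @homogeneousX K N U_(v)%MM; rewrite mdeg1.
Qed.

Lemma kos_hkos k (dg : 'I_k -> int) p j y S :
  kos (hkos dg p.+1 j y) S = hkos dg p j (kos y) S.
Proof.
have cU v : v \notin S -> (#|v |: S| == p.+1) = (#|S| == p).
  by move=> vS; rewrite cardsU1 vS eqSS.
rewrite /hkos; case: ifPn => Sp; last first.
  by rewrite /kos big1 // => v /cU ->; rewrite (negbTE Sp) scaler0.
rewrite /kos hrow_sum; apply: eq_bigr => v vS; rewrite cU // Sp.
rewrite (hrowZ _ _ _ (@homogeneous_sign v S)); congr (_ *: hrow _ _ _).
by rewrite -addn1 PoszD; ring.
Qed.

Lemma hkos_mul k l (dg : 'I_k -> int) (dg' : 'I_l -> int) (A : 'M[R]_(k, l)) p j y S :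
    (forall a b, homogeneous (dg a - dg' b) (A a b)) ->
  hkos dg' p j (fun S => y S *m A) S = hkos dg p j y S *m A.
Proof. by move=> hA; rewrite /hkos; case: ifP; rewrite ?mul0mx // (hrow_mul _ _ hA). Qed.

End KoszulRows.

Section DimensionShift.
Variables (K : fieldType) (N : nat) (M : lmodType {mpoly K[N]}).
Variables (gr : int -> M -> Prop) (C : free_complex M).
Hypothesis Cmin : minimal_graded_resolution gr C.
Local Notation R := {mpoly K[N]}.
Local Notation dg i := (@deg K N M C i).

Definition im_diff i (v : 'rV[R]_(rk C i)) := exists w, v = w *m diff C i.

(* The [p]-th Koszul homology, in degree [j], of the cokernel of [diff C i]
   (the [i]-th syzygy module) does not vanish. *)
Definition koszul_nonvanishing i p (j : int) :=
  exists y : {set 'I_N} -> 'rV[R]_(rk C i),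
  [/\ forall S, hkos (dg i) p j y S = y S,
      forall S, im_diff (kos y S) &
      ~ exists w, forall S, im_diff (y S - kos w S)].

Lemma diff_homogeneous i k l : homogeneous (dg i.+1 k - dg i l) (diff C i k l).
Proof. by case: Cmin => -[_ h] _ _; apply: h. Qed.

Lemma diff_exact i (v : 'rV_(rk C i.+1)) : v *m diff C i = 0 <-> im_diff v.
Proof. by case: Cmin => _ [_ _ h] _; apply: h. Qed.

Lemma diff_const i (w : 'rV_(rk C i.+1)) a : ((w *m diff C i) 0 a)@_0%MM = 0.
Proof.
case: Cmin => _ _ h; rewrite mxE raddf_sum big1 //= => k _.
by rewrite rmorphM /= h mulr0.
Qed.

(** The connecting map of 0 -> M_(i+1) -> F_i -> M_i -> 0, with M_i the cokernel of [diff C i]. The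
    Koszul complex of F_i is acyclic in positive degrees, and for p = 0 minimality makes
    H_0(M_(i+1)) -> H_0(F_i) zero. *)
Lemma koszul_nonvanishingS i p j :
  koszul_nonvanishing i.+1 p j <-> koszul_nonvanishing i p.+1 j.
Proof.
have hm y S : hkos (dg i) p j (fun S => y S *m diff C i) S = hkos (dg i.+1) p j y S *m diff C i.
  exact: (hkos_mul _ _ _ _ (@diff_homogeneous i)).
split=> [[y [hy cy ny]]|[y' [hy' cy' ny']]].
  have [||y0 y0E] := @kos_exact K N _ (fun S => y S *m diff C i).
  - by move=> S; rewrite kos_mul; apply/diff_exact.
  - by move=> a; apply: diff_const.
  pose y' := hkos (dg i) p.+1 j y0.
  have y'E S : kos y' S = y S *m diff C i.
    rewrite kos_hkos /hkos -y0E.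
    rewrite -[if _ then _ else _]/(hkos (dg i) p j (fun S => y S *m diff C i) S).
    by rewrite hm hy.
  exists y'; split=> [S|S|[w wP]]; first exact: hkosK.
    by exists (y S).
  apply: ny; have /choice[t tP] := wP; exists t => S; apply/diff_exact.
  rewrite mulmxBl -y'E -kos_mul -(eq_kos _ tP) kosB kos_kos subr0 subrr //.
have /choice[y0 y0E] := cy'; pose y := hkos (dg i.+1) p j y0.
have yE S : kos y' S = y S *m diff C i.
  rewrite -hm -(eq_kos _ hy') kos_hkos /hkos; case: ifP => // _.
  by rewrite y0E.
exists y; split=> [S|S|[t tP]]; first exact: hkosK.
  by apply/diff_exact; rewrite -kos_mul -(eq_kos _ yE) kos_kos.
apply: ny'; have [||w wE] := @kos_exact K N _ (fun S => y' S - t S *m diff C i).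
- move=> S; rewrite kosB kos_mul yE -mulmxBl; exact/diff_exact.
- move=> a; rewrite -hy' /hkos cards0 /= !mxE sub0r mcoeffN.
  by have := diff_const (t set0) a; rewrite mxE => ->; rewrite oppr0.
by exists w => S; exists (t S); rewrite -wE opprB addrC subrK.
Qed.

(** H_0 is the i-th syzygy module modulo the variables; by minimality the basis of F_i maps to a
    basis of it. *)
Lemma koszul_nonvanishing0 i j :
  koszul_nonvanishing i 0 j <-> exists k, dg i k = j.
Proof.
split=> [[y [hy cy ny]]|[k kj]].
  apply: contrapT => nk; apply: ny.
  have y0 S : S != set0 -> y S = 0 by rewrite -cards_eq0 -hy /hkos => /negbTE ->.
  have dy S : kos y S = 0.
    rewrite /kos big1 // => v _; rewrite y0 ?scaler0 //.
    by apply/set0Pn; exists v; rewrite setU11.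
  have [a|w wP] := kos_exact dy _; last first.
    by exists w => S; exists 0; rewrite wP subrr mul0mx.
  rewrite -hy /hkos cards0 mxE subr0 mcoeff_homz mdeg0 eq_sym subr_eq0.
  by case: eqP => // e; case: nk; exists a.
exists (fun S : {set 'I_N} => if #|S| == 0%N then (delta_mx 0 k : 'rV_(rk C i)) else 0); split.
- move=> S; rewrite /hkos; case: ifP => // S0; rewrite S0; apply/rowP=> a; rewrite !mxE /= subr0.
  case: (eqVneq a k) => [->|_] /=; last by rewrite homz0.
  by rewrite kj subrr homz_id // -mpolyC1; apply: homogeneousC.
- move=> S; exists 0; rewrite mul0mx /kos big1 // => v vS.
  by rewrite cardsU1 vS scaler0.
case=> w wP; have [t] := wP set0; rewrite cards0 /= => /rowP/(_ k)/(congr1 (mcoeff 0%MM)).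
rewrite diff_const !mxE !eqxx /= mcoeffB mcoeff1 eqxx kos_const subr0.
by move/eqP; rewrite oner_eq0.
Qed.

Lemma koszul_nonvanishing_shift i p j : koszul_nonvanishing i p j <-> koszul_nonvanishing 0 (i + p)%N j.
Proof.
elim: i p => [|i IHi] p; first by [].
by rewrite koszul_nonvanishingS IHi addSnnS.
Qed.

End DimensionShift.

(** * The Stanley-Reisner ring *)

Section VanishingIdeal.
Variables (K : fieldType) (N : nat) (P : pred {set 'I_N}).
Local Notation R := {mpoly K[N]}.
Implicit Types p : R.
Hypothesis PS : forall S T : {set 'I_N}, S \subset T -> P T -> P S.

Lemma vanishes_on_sum (I : Type) (r : seq I) (Q : pred I) (f : I -> R) :
  (forall i, Q i -> vanishes_on P (f i)) -> vanishes_on P (\sum_(i <- r | Q i) f i).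
Proof. by move=> h m Pm; rewrite raddf_sum big1 //= => i Qi; apply: h. Qed.

Lemma vanishes_onM p q : vanishes_on P q -> vanishes_on P (p * q).
Proof.
move=> hq m Pm; rewrite mcoeffM big1 // => k /eqP mE.
rewrite hq ?mulr0 //; apply: PS Pm; apply/subsetP=> v; rewrite !inE => kv.
by rewrite mE mnmDE addn_gt0 kv orbT.
Qed.

Lemma vanishes_on_kpoly (q : {set 'I_N} -> R) S :
  (forall S, vanishes_on P (q S)) -> vanishes_on P (kpoly q S).
Proof. by move=> hq; apply: vanishes_on_sum => v _; apply: vanishes_onM. Qed.

Lemma vanishes_on_homz z p : vanishes_on P p -> vanishes_on P (homz z p).
Proof. by move=> hp m Pm; rewrite mcoeff_homz hp // if_same. Qed.

End VanishingIdeal.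

Lemma mpolyX_factor (K : fieldType) N (m k : 'X_{1..N}) : (k <= m)%MM ->
  ('X_[m] : {mpoly K[N]}) = 'X_[(m - k)] * 'X_[k].
Proof. by move=> km; rewrite -mpolyXD submK. Qed.

Lemma mesym1_supp N (m : 'X_{1..N}) : (mesym1 (mnm_supp m) <= m)%MM.
Proof. by apply/mnm_lepP=> v; rewrite mnmE inE; case: (m v). Qed.

Section StanleyReisnerRing.
Variables (K : fieldType) (V : finType) (D : scomplex V).
Local Notation N := #|V|.
Local Notation R := {mpoly K[N]}.
Local Notation Q := (SR_ring K D).
Implicit Types (p q : R) (T : {set 'I_N}) (F : {set V}).

Definition vface T := [set enum_val i | i in T] \in faces D.
Definition rank_set F : {set 'I_N} := [set enum_rank v | v in F].

Lemma vfaceS T T' : T \subset T' -> vface T' -> vface T.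
Proof. by move=> TT'; apply: faceS; apply: imsetS. Qed.

Lemma enum_rank_setK F : [set enum_val i | i in rank_set F] = F.
Proof.
rewrite -imset_comp -[RHS]imset_id; apply: eq_imset => v /=; exact: enum_rankK.
Qed.

Lemma enum_val_setK T : rank_set [set enum_val i | i in T] = T.
Proof.
rewrite /rank_set -imset_comp -[RHS]imset_id; apply: eq_imset => v /=; exact: enum_valK.
Qed.

Lemma face_monomialE F : face_monomial K F = 'X_[mesym1 (rank_set F)].
Proof.
rewrite /face_monomial mprodXE; congr 'X_[_]; apply/mnmP=> i.
rewrite mnm_sumE mnmE; case: imsetP => [[v vF ->]|nF].
  rewrite (bigD1 v) //= mnm1E eqxx big1 // => u /andP[_ uv].
  by rewrite mnm1E (inj_eq enum_rank_inj) (negbTE uv).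
rewrite big1 // => v vF; rewrite mnm1E; case: eqP => // e.
by case: nF; exists v.
Qed.

(** A monomial is a multiple of its squarefree part, which is a generator when the support is a
    nonface. *)
Lemma SR_idealE p : p \in SR_ideal D <-> vanishes_on vface p.
Proof.
split=> [/asboolP[k [c [g [Sg ->]]]] | hp].
  apply: vanishes_on_sum => i _; apply: (vanishes_onM vfaceS).
  have [F FD ->] := Sg i; rewrite face_monomialE => m Pm.
  rewrite mcoeffX; case: eqP => // mE; move: Pm; rewrite -mE /vface.
  by rewrite mnm_supp_set enum_rank_setK (negbTE FD).
rewrite [p]mpolyE big_seq rpred_sum // => m mp.
rewrite (mpolyX_factor _ (mesym1_supp m)) scalerAl idealMr //.
have nf : ~~ vface (mnm_supp m).
  by apply: contraTN mp => /hp e; rewrite mcoeff_msupp e eqxx.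
apply/asboolP; exists 1%N, (fun=> 1), (fun=> 'X_[mesym1 (mnm_supp m)]); split=> [_|].
  exists [set enum_val i | i in mnm_supp m]; first exact: nf.
  by rewrite face_monomialE enum_val_setK.
by rewrite big_ord1 mul1r.
Qed.

Definition srpi p : Q := (\pi_Q p)%qT.

Lemma srpi_eq0 p : srpi p = 0 <-> vanishes_on vface p.
Proof.
rewrite -SR_idealE -[p in p \in _]subr0 (Quotient.idealrBE (SR_ideal D)).
have pi0 : srpi 0 = 0 := rmorph0 \pi_Q%qT.
split=> [h|/eqP h]; last exact: etrans h pi0.
by apply/eqP; apply: etrans h (esym pi0).
Qed.

Lemma srpiD p q : srpi (p + q) = srpi p + srpi q.
Proof. exact: (rmorphD \pi_Q%qT). Qed.
Lemma srpiB p q : srpi (p - q) = srpi p - srpi q.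
Proof. exact: (rmorphB \pi_Q%qT). Qed.
Lemma srpi_sum (I : Type) (r : seq I) (P : pred I) (f : I -> R) :
  srpi (\sum_(i <- r | P i) f i) = \sum_(i <- r | P i) srpi (f i).
Proof. exact: (rmorph_sum \pi_Q%qT). Qed.
Lemma srpiM p q : srpi (p * q) = srpi p * srpi q.
Proof. exact: (rmorphM \pi_Q%qT). Qed.
Lemma srpi1 : srpi 1 = 1.
Proof. exact: (rmorph1 \pi_Q%qT). Qed.
Lemma srpi_prod (I : Type) (r : seq I) (P : pred I) (f : I -> R) :
  srpi (\prod_(i <- r | P i) f i) = \prod_(i <- r | P i) srpi (f i).
Proof. exact: (big_morph srpi srpiM srpi1). Qed.
Lemma srpiX n p : srpi (p ^+ n) = srpi p ^+ n.
Proof. by elim: n => [|n IHn]; rewrite ?srpi1 // !exprS srpiM IHn. Qed.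
Lemma srpiZ p q : p *: srpi q = srpi (p * q).
Proof. by rewrite srpiM. Qed.
Lemma srpi_repr (x : Q) : srpi (repr x) = x.
Proof. exact: reprK. Qed.

End StanleyReisnerRing.

Section StanleyReisnerKoszul.
Variables (K : fieldType) (V : finType) (D : scomplex V).
Local Notation N := #|V|.
Local Notation R := {mpoly K[N]}.
Variable C : free_complex (SR_ring K D).
Hypothesis Cmin : minimal_graded_resolution (@SR_grading K V D) C.
Local Notation dg0 := (@deg K N (SR_ring K D) C 0).
Local Notation vanish := (vanishes_on (@vface V D)).

(** Lifting F_0 -> K[D] to a matrix over R lets Koszul chains of F_0 be compared with polynomial
    chains modulo the Stanley-Reisner ideal. *)
Lemma aug_lift : exists a : 'M[R]_(rk C 0, 1),
  (forall k l, homogeneous (dg0 k - 0) (a k l)) /\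
  forall v, augment v = srpi D ((v *m a) 0 0).
Proof.
have [[ha _] _ _] := Cmin; have /choice[a aP] : forall k, exists a,
    homogeneous (dg0 k) a /\ aug k = srpi D a.
  by move=> k; have [p hp ->] := ha k; exists p.
exists (\col_k a k); split=> [k l|v]; first by rewrite mxE subr0; case: (aP k).
rewrite /augment mxE srpi_sum; apply: eq_bigr => k _.
by rewrite mxE; have [_ ->] := aP k; rewrite srpiZ.
Qed.

Lemma koszul_nonvanishing_facesP s p j : vface D =1 is_face s -> rshelling s ->
  koszul_nonvanishing C 0 p j -> j - p%:Z <= (max_restriction s)%:Z.
Proof.
move=> sE sh [y [hy cy ny]]; have [a [ha aE]] := aug_lift.
have [_ [surj ex0 _] _] := Cmin.
have im0 v : im_diff v <-> vanish ((v *m a) 0 0).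
  by rewrite -(srpi_eq0 D) -aE ex0.
rewrite leNgt; apply/negP => jr; apply: ny.
pose q S := (y S *m a) 0 0.
have kq z S : kpoly (fun S => (z S *m a) 0 0) S = (kos z S *m a) 0 0.
  by rewrite -kos_mul kosE.
have [||S|w wP] := @kpoly_face_exact K N s p q sh.
- by move=> S Sp; rewrite /q -hy /hkos (negbTE Sp) mul0mx mxE.
- move=> S m; rewrite /q -hy /hkos; case: ifP => [_|]; last by rewrite mul0mx mxE mcoeff0 eqxx.
  rewrite -(hrow_mul (dg' := fun=> 0) _ _ ha) mxE subr0 -mcoeff_msupp => /homz_homogeneous mj.
  by move: jr; rewrite -mj ltz_nat.
- by move=> m; rewrite -sE; move: m; rewrite -/(vanish _) kq; apply/im0.
have /choice[v vP] (S : {set 'I_N}) : exists v : 'rV_(rk C 0), w S - (v *m a) 0 0 \in SR_ideal D.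
  have [v vE] := surj (srpi D (w S)); exists v; apply/SR_idealE/srpi_eq0.
  by rewrite srpiB -aE vE subrr.
exists v => S; apply/im0.
have -> : ((y S - kos v S) *m a) 0 0 = q S - kpoly (fun S => (v S *m a) 0 0) S.
  by rewrite kq mulmxBl /q !mxE.
rewrite -[q S](subrK (kpoly w S)) -addrA => m fm; rewrite mcoeffD.
rewrite (wP S m) -?sE // add0r; move: m fm.
have -> : kpoly w S - kpoly (fun S => (v S *m a) 0 0) S =
    kpoly (fun S => w S - (v S *m a) 0 0) S.
  by rewrite /kpoly -sumrB; apply: eq_bigr => u _; rewrite mulrBr.
by apply: (vanishes_on_kpoly (@vfaceS _ D)) => S'; apply/SR_idealE.
Qed.


Lemma koszul_nonvanishing_faces s (q : {set 'I_N} -> R) p j : vface D =1 is_face s ->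
    j - p%:Z = (max_restriction s)%:Z ->
    (forall S : {set 'I_N}, #|S| != p -> q S = 0) ->
    (forall S m, (q S)@_m != 0 -> mdeg m = max_restriction s) ->
    (forall S, vanishes_on (is_face s) (kpoly q S)) ->
    ~ (exists w, forall S, vanishes_on (is_face s) (q S - kpoly w S)) ->
  koszul_nonvanishing C 0 p j.
Proof.
move=> sE jp qp qd dq nq; have [a [ha aE]] := aug_lift.
have vE r : vanishes_on (is_face s) r <-> vanish r.
  by split=> h m fm; apply: h; rewrite ?sE // -sE.
have [_ [surj ex0 _] _] := Cmin.
have im0 v : im_diff v <-> vanish ((v *m a) 0 0).
  by rewrite -(srpi_eq0 D) -aE ex0.
have kq (z : {set 'I_N} -> 'rV_(rk C 0)) S :
    kpoly (fun S => (z S *m a) 0 0) S = (kos z S *m a) 0 0.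
  by rewrite -kos_mul kosE.
have /choice[v vP] (S : {set 'I_N}) : exists v : 'rV_(rk C 0), vanish (q S - (v *m a) 0 0).
  have [v vq] := surj (srpi D (q S)); exists v; apply/srpi_eq0.
  by rewrite srpiB -aE vq subrr.
(* Since [q] already has bidegree (p, j), cutting [v] down to it preserves the congruence. *)
have yP S : vanish (q S - (hkos dg0 p j v S *m a) 0 0).
  rewrite /hkos; case: ifPn => Sp; last by rewrite qp // mul0mx mxE subrr => m _; rewrite mcoeff0.
  rewrite -(hrow_mul (dg' := fun=> 0) _ _ ha) mxE subr0.
  have -> : q S = homz (j - p%:Z) (q S).
    by rewrite homz_id // => m; rewrite mcoeff_msupp => /qd ->.
  move=> m fm; rewrite mcoeffB !mcoeff_homz; case: ifP => _; rewrite ?subrr //.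
  by rewrite -mcoeffB vP.
have kE z z' S : kpoly z S - kpoly z' S = kpoly (fun S => z S - z' S) S :> R.
  by rewrite /kpoly -sumrB; apply: eq_bigr => u _; rewrite mulrBr.
have kv z S : (forall S, vanish (z S)) -> vanish (kpoly z S).
  exact: (vanishes_on_kpoly (@vfaceS _ D)).
pose r S := (hkos dg0 p j v S *m a) 0 0.
exists (hkos dg0 p j v); split=> [S|S|[w wP]]; first exact: hkosK.
  apply/im0; rewrite -kq -/r.
  have -> : kpoly r S = kpoly q S - kpoly (fun S => q S - r S) S.
    by rewrite kE /kpoly; apply: eq_bigr => u _; rewrite subKr.
  by apply: vanishes_onB; [exact/vE | exact: kv].
apply: nq; exists (fun S => (w S *m a) 0 0) => S; apply/vE.
have -> : q S - kpoly (fun S => (w S *m a) 0 0) S =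
    (q S - r S) - - ((hkos dg0 p j v S - kos w S) *m a) 0 0.
  by rewrite kq mulmxBl opprK /r !mxE addrA subrK.
apply: vanishes_onB => //; have /im0 h := wP S.
by move=> m fm; rewrite mcoeffN h // oppr0.
Qed.

End StanleyReisnerKoszul.

Section Regularity.

Lemma choice_ofP (T : Type) (x0 : T) (P : T -> Prop) : (exists x, P x) -> P (choice_of x0 P).
Proof. by move=> ex; rewrite /choice_of; case: pselect => // e; case: cid. Qed.

Lemma maxzE (S : int -> Prop) r : S r -> (forall z, S z -> z <= r) -> maxz S = r.
Proof.
move=> Sr rmax; have [|Sm mmax] := @choice_ofP _ 0 (fun r => S r /\ forall z, S z -> z <= r).
  by exists r.
by apply: le_anti; rewrite mmax // rmax.
Qed.

End Regularity.

(** * Existence of minimal graded resolutions *)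

Section Dickson.
Local Open Scope nat_scope.

(** Each chosen index minimizes [a] over a tail of the sequence that contains all later choices. *)
Lemma nondecreasing_subseq (a : nat -> nat) :
  exists g : nat -> nat, {homo g : i j / i < j} /\ {homo a \o g : i j / i <= j}.
Proof.
have minE i : exists j, i <= j /\ forall k, i <= k -> a j <= a k.
  have ex : exists n, `[< exists2 j, i <= j & a j = n >] by exists (a i); apply/asboolP; exists i.
  case: (ex_minnP ex) => n /asboolP[j ij <-] jmin; exists j; split=> // k ik.
  by apply: jmin; apply/asboolP; exists k.
have /choice[f fP] := minE; pose g := fix g i := if i is i'.+1 then f (g i').+1 else f 0.
have gS i : g i < g i.+1 by have [] := fP (g i).+1.
exists g; split; first exact: homo_ltn ltn_trans gS.
apply: homo_leq => [//|? ? ?|i] /=; first exact: leq_trans.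
case: i => [|i] /=.
  by have [_] := fP 0; apply.
have [_] := fP (g i).+1; apply; apply: ltn_trans (gS _) (gS _).
Qed.

Lemma dickson_seq n (f : nat -> 'X_{1..n}) : exists i j, i < j /\ (f i <= f j)%MM.
Proof.
have mono k : k <= n -> exists g : nat -> nat, {homo g : i j / i < j} /\
    forall v : 'I_n, v < k -> {homo (fun i => f (g i) v) : i j / i <= j}.
  elim: k => [|k IHk] kn; first by exists id; split=> [i j|v].
  have [g [gS gm]] := IHk (ltnW kn).
  have [h [hS hm]] := nondecreasing_subseq (fun i => f (g i) (Ordinal kn)).
  exists (g \o h); split=> [i j ij|v]; first by apply/gS/hS.
  rewrite ltnS leq_eqVlt => /orP[/eqP vk|vk] i j ij /=.
    by have -> : v = Ordinal kn by [apply/val_inj]; apply: hm.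
  by apply: gm => //; apply: (ltnW_homo hS).
have [g [gS gm]] := mono n (leqnn n); exists (g 0), (g 1); split; first exact: gS.
by apply/mnm_lepP=> v; apply: gm.
Qed.

(** Otherwise every finite list in [A] could be extended by an element of [A] divisible by none of
    its members, and iterating would contradict [dickson_seq]. *)
Lemma dickson n (A : 'X_{1..n} -> Prop) : exists L : seq 'X_{1..n},
  (forall m, m \in L -> A m) /\ forall m, A m -> exists2 l, l \in L & (l <= m)%MM.
Proof.
apply: contrapT => nL.
have /choice[F FP] (L : seq 'X_{1..n}) : exists m, (forall m, m \in L -> A m) ->
    A m /\ forall l, l \in L -> ~~ (l <= m)%MM.
  have [LA|nLA] := pselect (forall m, m \in L -> A m); last by exists 0%MM.
  apply: contrapT => nm; apply: nL; exists L; split=> // m Am.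
  apply: contrapT => nl; apply: nm; exists m => _; split=> // l lL.
  by apply/negP => lm; apply: nl; exists l.
pose Ls := fix Ls i := if i is i'.+1 then F (Ls i') :: Ls i' else [::].
have LsA i : forall m, m \in Ls i -> A m.
  elim: i => [|i IHi] m //=; rewrite inE => /orP[/eqP->|/IHi//].
  by have [] := FP _ IHi.
have [i [j [ij le]]] := dickson_seq (fun i => F (Ls i)).
have FL : F (Ls i) \in Ls j.
  elim: j ij {le} => // j IHj; rewrite ltnS leq_eqVlt => /orP[/eqP->|/IHj].
    by rewrite inE eqxx.
  by rewrite inE orbC => ->.
by have [_ /(_ _ FL)] := FP _ (LsA j); rewrite le.
Qed.

End Dickson.

(** * Finite and minimal homogeneous generation of submodules *)

Section Noetherian.
Variables (K : fieldType) (N : nat).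
Local Notation R := {mpoly K[N]}.

(** Hilbert's basis theorem: take elements whose leading monomials form a Dickson basis, and divide
    by well-founded induction on the leading monomial. *)
Lemma ideal_fin_gen (I : R -> Prop) :
    (forall p q, I p -> I q -> I (p + q)) -> (forall a p, I p -> I (a * p)) ->
  exists l (g : 'I_l -> R), (forall i, I (g i)) /\
    forall p, I p -> exists c : 'I_l -> R, p = \sum_i c i * g i.
Proof.
move=> ID IM; have [L [LA AL]] := dickson (fun m => exists2 p, I p /\ p != 0 & mlead p = m).
have gex (i : 'I_(size L)) : exists p, [/\ I p, p != 0 & mlead p = nth 0%MM L i].
  by have [|p [Ip p0] pm] := LA (nth 0%MM L i); [exact: mem_nth | exists p].
have /choice[g gP] := gex; exists (size L), g; split=> [i|]; first by case: (gP i).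
move=> p; move: {2}(mlead p) (erefl (mlead p)) => m; move: m p.
apply: (well_founded_ind (@ltom_wf N)) => m IH p pm Ip.
have [->|p0] := eqVneq p 0.
  by exists (fun=> 0); rewrite big1 // => i _; rewrite mul0r.
have [|l lL lm] := AL m; first by exists p.
have [Ig g0 gl] := gP (Ordinal (etrans (index_mem l L) lL)).
rewrite /= nth_index // in gl; set i := Ordinal _ in Ig g0 gl.
pose a : R := (mleadc p / mleadc (g i)) *: 'X_[m - l].
have lg0 : mleadc (g i) != 0 by rewrite mleadc_eq0.
have lp0 : mleadc p != 0 by rewrite mleadc_eq0.
have a0 : a != 0.
  rewrite /a -mul_mpolyC mulf_neq0 ?mpolyC_eq0 ?mulf_neq0 ?invr_eq0 //.
  by apply/eqP=> /(congr1 (mcoeff (m - l)%MM)) /eqP; rewrite mcoeffX eqxx mcoeff0 oner_eq0.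
have ma : mlead a = (m - l)%MM by rewrite mleadZ ?mleadXm // mulf_neq0 ?invr_eq0.
have mag : mlead (a * g i) = m by rewrite mleadM // ma gl submK.
pose p' := p - a * g i.
have p'm : p'@_m = 0.
  rewrite mcoeffB -{2}mag mleadM // mleadcM -[in RHS](subrr p@_m); congr (_ - _).
  rewrite ma mcoeffZ mcoeffX eqxx mulr1 mulfVK //.
  by rewrite pm.
have Ip' : I p' by apply: ID => //; rewrite -mulNr; apply: IM.
have [c cE] : exists c : 'I_(size L) -> R, p' = \sum_i c i * g i.
  have [p'0|p'0] := eqVneq p' 0.
    by exists (fun=> 0); rewrite big1 // => k _; rewrite mul0r.
  apply: (IH (mlead p')) => //; rewrite lt_neqAle; apply/andP; split.
    by apply: contra_eq_neq p'm => <-; rewrite mleadc_eq0.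
  by apply: le_trans (mleadB_le _ _) _; rewrite mag pm joinxx.
exists (fun k => c k + if k == i then a else 0).
rewrite -[p](subrK (a * g i)) -/p' cE.
under [in RHS]eq_bigr do rewrite mulrDl.
rewrite big_split /=; congr (_ + _).
by rewrite (bigD1 i) //= eqxx big1 ?addr0 // => k /negbTE ->; rewrite mul0r.
Qed.

Definition submodule k (P : 'rV[R]_k -> Prop) :=
  [/\ P 0, forall u v, P u -> P v -> P (u + v) & forall a v, P v -> P (a *: v)].

Lemma submodule_mul k (P : 'rV[R]_k -> Prop) l (A : 'M_(l, k)) (w : 'rV_l) :
  submodule P -> (forall i, P (row i A)) -> P (w *m A).
Proof.
move=> [P0 PD PZ] PA; rewrite mulmx_sum_row; elim/big_ind: _ => // i _; exact: PZ.
Qed.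

Lemma submodule_fin_gen k (P : 'rV[R]_k -> Prop) : submodule P ->
  exists l (A : 'M_(l, k)), forall v, P v <-> exists w, v = w *m A.
Proof.
move=> sP; have [P0 PD PZ] := sP.
(* Downward induction on the number [t] of leading zero coordinates: the next coordinates form an
   ideal of R, and lifts of its generators reduce [t] to [t.+1]. *)
pose Pt t (v : 'rV_k) := P v /\ forall i : 'I_k, (i < t)%N -> v 0 i = 0.
suff /(_ k 0%N erefl)[l [A [PA AP]]] : forall d t, (t + d = k)%N ->
    exists l (A : 'M_(l, k)), (forall i, P (row i A)) /\
    forall v, Pt t v -> exists w, v = w *m A.
  exists l, A => v; split=> [Pv|[w ->]]; last exact: submodule_mul.
  by apply: AP; split.
elim=> [|d IHd] t td.
  exists 0%N, 0; split=> [[]//|v [_ v0]]; exists 0; rewrite mul0mx.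
  by apply/rowP=> i; rewrite mxE v0 // -[t]addn0 td.
have [|l [A [PA AP]]] := IHd t.+1; first by rewrite addSnnS.
have tk : (t < k)%N by rewrite -td -addSnnS leq_addr.
set T := Ordinal tk.
have [||l' [g [Jg gJ]]] := @ideal_fin_gen (fun p => exists2 v, Pt t v & v 0 T = p).
- move=> _ _ [u [Pu u0] <-] [v [Pv v0] <-]; exists (u + v); rewrite ?mxE //.
  by split=> [|i it]; [exact: PD | rewrite mxE u0 ?v0 ?addr0].
- move=> a _ [v [Pv v0] <-]; exists (a *: v); rewrite ?mxE //.
  by split=> [|i it]; [exact: PZ | rewrite mxE v0 ?mulr0].
have /choice[h hP] i : exists v, Pt t v /\ v 0 T = g i.
  by have [v] := Jg i; exists v.
pose B := \matrix_i h i.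
have PB i : P (row i B) by rewrite rowK; case: (hP i) => -[].
exists (l' + l)%N, (col_mx B A); split=> [i|v [Pv v0]].
  by case: (split_ordP i) => j ->; rewrite ?rowKu ?rowKd.
have [|c cE] := gJ (v 0 T); first by exists v.
pose u := \row_i c i : 'rV_l'.
have uB i : (u *m B) 0 i = \sum_j c j * h j 0 i.
  by rewrite mxE; apply: eq_bigr => j _; rewrite !mxE.
have [|w wE] := AP (v - u *m B).
  split.
    rewrite -scaleN1r; apply: PD => //; apply: PZ; exact: submodule_mul.
  move=> i; rewrite ltnS leq_eqVlt => /orP[/eqP iT|it]; rewrite mxE [X in _ + X]mxE uB.
    have -> : i = T by apply: val_inj.
    by rewrite cE -sumrB big1 // => j _; case: (hP j) => _ ->; rewrite subrr.
  rewrite v0 // big1 ?subrr // => j _; case: (hP j) => -[_ h0] _.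
  by rewrite h0 ?mulr0.
by exists (row_mx u w); rewrite mul_row_col -wE addrC subrK.
Qed.

Lemma hrow_decomposition k (dg : 'I_k -> int) (v : 'rV[R]_k) :
  exists Z : seq int, v = \sum_(z <- Z) hrow dg z v.
Proof.
pose b := (\max_(i < k) msize (v 0%R i))%N.
pose Z := undup [seq dg i + (e : nat)%:Z | i <- enum 'I_k, e <- iota 0 b].
exists Z; apply/rowP=> i; apply/mpolyP=> m; rewrite summxE raddf_sum /=.
under eq_bigr do rewrite mxE mcoeff_homz.
have [vm|vm] := eqVneq (v 0 i)@_m 0.
  by rewrite big1 // => z _; rewrite vm if_same.
have mZ : dg i + (mdeg m)%:Z \in Z.
  rewrite mem_undup; apply/allpairsP; exists (i, mdeg m); split; rewrite ?mem_enum //.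
  rewrite mem_iota /= add0n; apply: (@leq_trans (msize (v 0 i))).
    by apply: msize_mdeg_lt; rewrite mcoeff_msupp.
  exact: (@leq_bigmax _ (fun i => msize (v 0 i))).
rewrite (big_rem _ mZ) /= [dg i + _]addrC addrK eqxx big1_seq ?addr0 // => z.
rewrite rem_filter ?undup_uniq // mem_filter => /and3P[_ /= zm _].
by case: eqP => // e; case/eqP: zm; rewrite e; ring.
Qed.

Definition graded_mx k l (dg : 'I_k -> int) (dg' : 'I_l -> int) (A : 'M[R]_(k, l)) :=
  forall a b, homogeneous (dg a - dg' b) (A a b).

(** The homogeneous components of finitely many generators are again generators in the module. *)
Lemma graded_fin_gen k (dg : 'I_k -> int) (P : 'rV[R]_k -> Prop) :
    submodule P -> (forall z v, P v -> P (hrow dg z v)) ->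
  exists l (dg' : 'I_l -> int) (A : 'M_(l, k)),
    graded_mx dg' dg A /\ forall v, P v <-> exists w, v = w *m A.
Proof.
move=> sP gP; have [l [A AP]] := submodule_fin_gen sP.
have /choice[Z ZE] i := hrow_decomposition dg (row i A).
pose T : finType := {i : 'I_l & 'I_(size (Z i))}.
pose zT (t : T) := (Z (tag t))`_(tagged t).
pose B : 'M_(#|T|, k) := \matrix_r hrow dg (zT (enum_val r)) (row (tag (enum_val r)) A).
have PB r : P (row r B).
  by rewrite rowK; apply: gP; apply/AP; exists (delta_mx 0 (tag (enum_val r))); rewrite rowE.
exists #|T|, (fun r => zT (enum_val r)), B; split=> [r b|v].
  by rewrite !mxE; apply: homz_homogeneous.
split=> [/AP[w ->]|[w ->]]; last exact: submodule_mul.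
exists (\row_r w 0 (tag (enum_val r))).
pose f i (e : 'I_(size (Z i))) := w 0 i *: hrow dg (Z i)`_e (row i A).
transitivity (\sum_(t : T) f (tag t) (tagged t)); last first.
  rewrite mulmx_sum_row (big_enum_val (A := T)).
  by apply: eq_bigr => r _; rewrite rowK mxE.
transitivity (\sum_i \sum_e f i e); last by rewrite sig_big_dep.
rewrite mulmx_sum_row.
apply: eq_bigr => i _; rewrite -scaler_sumr {1}ZE; congr (_ *: _).
by rewrite (big_nth 0) big_mkord.
Qed.

(** In a shortest list of homogeneous generators, no relation has a coefficient with nonzero
    constant term, since such a relation would eliminate a generator. *)
Lemma minimal_generators k (dg : 'I_k -> int) (P : 'rV[R]_k -> Prop) :
    submodule P -> (forall z v, P v -> P (hrow dg z v)) ->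
  exists l (dg' : 'I_l -> int) (A : 'M_(l, k)),
    [/\ graded_mx dg' dg A, forall v, P v <-> exists w, v = w *m A &
        forall w : 'rV_l, w *m A = 0 -> forall a, (w 0 a)@_0%MM = 0].
Proof.
move=> sP gP; pose gens l := exists (dg' : 'I_l -> int) (A : 'M_(l, k)),
    graded_mx dg' dg A /\ forall v, P v <-> exists w, v = w *m A.
have ex : exists l, `[< gens l >].
  by have [l h] := graded_fin_gen sP gP; exists l; apply/asboolP.
case: (ex_minnP ex) => l /asboolP[dg' [A [gA AP]]] lmin.
exists l, dg', A; split=> // w wA a; apply/eqP; apply/negPn/negP => c0.
move: dg' A gA AP lmin w wA a c0; case: l => [|l] dg' A gA AP lmin w wA a c0.
  by case: a c0.
suff /asboolP/lmin : gens l by rewrite ltnn.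
exists (dg' \o lift a), (row' a A); split=> [i b|v]; first by rewrite mxE; apply: gA.
(* In this degree the coefficient of generator [a] is exactly the constant [c], a unit. *)
pose w' := hrow dg' (dg' a) w.
have w'A : w' *m A = 0 by rewrite -(hrow_mul _ _ gA) wA hrow0.
set c := (w 0 a)@_0%MM in c0.
have w'a : w' 0 a = c%:MP.
  rewrite mxE subrr; apply/mpolyP=> m; rewrite mcoeff_homz mcoeffC.
  have [->|m0] := eqVneq m 0%MM; first by rewrite mdeg0 eqxx mulr1.
  by rewrite eqz_nat mdeg_eq0 (negbTE m0) mulr0.
have rowA (u : 'rV_l.+1) : u *m A = u 0 a *: row a A + col' a u *m row' a A.
  rewrite !mulmx_sum_row (bigD1_ord a) //=; congr (_ + _); apply: eq_bigr => i _.
  by rewrite mxE; congr (_ *: _); apply/rowP=> j; rewrite !mxE.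
split=> [/AP[u ->]|[u ->]].
  pose d := u 0 a * (c^-1)%:MP.
  exists (col' a (u - d *: w')).
  have : (u - d *: w') *m A = u *m A by rewrite mulmxBl -scalemxAl w'A scaler0 subr0.
  rewrite rowA => <-; suff -> : (u - d *: w') 0 a = 0 by rewrite scale0r add0r.
  rewrite mxE [X in _ + X]mxE [X in _ - X]mxE w'a /d -mulrA -mpolyCM mulVf //.
  by rewrite mpolyC1 mulr1 subrr.
apply/AP; exists (\row_i if unlift a i is Some j then u 0 j else 0).
rewrite rowA mxE unlift_none scale0r add0r; congr (_ *m _).
by apply/rowP=> i; rewrite !mxE liftK.
Qed.

End Noetherian.

(** * Iterated construction of a resolution *)

Section Resolution.
Variables (K : fieldType) (N : nat).
Local Notation R := {mpoly K[N]}.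

Record stage := Stage {
  srk : nat; sdeg : 'I_srk -> int;
  srk' : nat; sdeg' : 'I_srk' -> int;
  sdiff : 'M[R]_(srk', srk) }.

(** Gradedness is a premise, so that a successor can be chosen for every stage and the recursion
    carries no invariant. *)
Definition next_spec (st : stage)
    (p : {l : nat & (('I_l -> int) * 'M[R]_(l, srk' st))%type}) :=
  graded_mx (@sdeg' st) (@sdeg st) (sdiff st) ->
  let: (dg, A) := tagged p in
  [/\ graded_mx dg (@sdeg' st) A,
      forall v : 'rV_(srk' st), v *m sdiff st = 0 <-> exists w, v = w *m A &
      forall w : 'rV_(tag p), w *m A = 0 -> forall a, (w 0 a)@_0%MM = 0].

Lemma next_exists st : exists p, @next_spec st p.
Proof.
have [gA|nA] := pselect (graded_mx (@sdeg' st) (@sdeg st) (sdiff st)); last first.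
  by exists (existT (fun l => ('I_l -> int) * 'M[R]_(l, srk' st))%type 0%N (fun=> 0, 0)) => /nA.
have [||l [dg [A h]]] := @minimal_generators K N _ (@sdeg' st) (fun v => v *m sdiff st = 0).
- split=> [|u v u0 v0|a v v0]; first by rewrite mul0mx.
    by rewrite mulmxDl u0 v0 addr0.
  by rewrite -scalemxAl v0 scaler0.
- by move=> z v v0; rewrite -(hrow_mul _ _ gA) v0 hrow0.
by exists (existT _ l (dg, A)).
Qed.

Definition next_stage st : stage :=
  let p := projT1 (cid (next_exists st)) in
  Stage (@sdeg' st) (tagged p).1 (tagged p).2.

Lemma nextP st : graded_mx (@sdeg' st) (@sdeg st) (sdiff st) ->
  [/\ graded_mx (@sdeg' (next_stage st)) (@sdeg (next_stage st)) (sdiff (next_stage st)),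
      forall v : 'rV_(srk' st), v *m sdiff st = 0 <->
        exists w : 'rV_(srk' (next_stage st)), v = w *m sdiff (next_stage st) &
      forall w : 'rV_(srk' (next_stage st)), w *m sdiff (next_stage st) = 0 ->
        forall a, (w 0 a)@_0%MM = 0].
Proof.
rewrite /next_stage; case: cid => -[l [dg A]] /= h gA; exact: h.
Qed.

Variables (M : lmodType R) (gr : int -> M -> Prop).

(** The last two hypotheses say that the annihilator of [x] lies in the ideal of the variables and
    is graded. *)
Lemma cyclic_resolution (x : M) :
    gr 0 x -> (forall y : M, exists a : R, a *: x = y) ->
    (forall a : R, a *: x = 0 -> a@_0%MM = 0) ->
    (forall z (a : R), a *: x = 0 -> homz z a *: x = 0) ->
  exists C : free_complex M, minimal_graded_resolution gr C.
Proof.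
move=> grx gen const hom.
have [||l [dg [A [gA AP Amin]]]] := @minimal_generators K N 1 (fun=> 0)
  (fun v => v 0 0 *: x = 0).
- split=> [|u v u0 v0|a v v0]; rewrite ?mxE ?scale0r //.
    by rewrite scalerDl u0 v0 addr0.
  by rewrite -scalerA v0 scaler0.
- by move=> z v v0; rewrite mxE; apply: hom.
pose st i := iter i next_stage (Stage (fun=> 0) dg A).
have gst i : graded_mx (@sdeg' (st i)) (@sdeg (st i)) (sdiff (st i)).
  by elim: i => [|i IHi] //=; have [] := nextP IHi.
have minst i (w : 'rV_(srk' (st i))) : w *m sdiff (st i) = 0 -> forall a, (w 0 a)@_0%MM = 0.
  by case: i w => [|i] w /=; [exact: Amin | have [_ _] := nextP (gst i); apply].
have exst i (v : 'rV_(srk' (st i))) : v *m sdiff (st i) = 0 <->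
    exists w : 'rV_(srk' (st i.+1)), v = w *m sdiff (st i.+1).
  by have [_ h _] := nextP (gst i); apply: h.
pose C : free_complex M := @FreeComplex K N M (fun i => srk (st i))
  (fun i => @sdeg (st i)) (fun i => sdiff (st i)) (fun _ : 'I_1 => x).
have augE v : @augment K N M C v = v 0 0 *: x by rewrite /augment big_ord1.
exists C; split; first by split=> [k|i k l']; [exact: grx | exact: gst].
  split=> [y|v|i v].
  - have [a <-] := gen y; exists (\row_k a); by rewrite augE mxE.
  - by rewrite augE; apply: AP.
  - exact: exst.
(* The rows of each differential are relations among the generators chosen before, so their constant
   terms vanish. *)
move=> i k l'; case: i k l' => [|i] k l'.
  have -> : l' = 0 :> 'I_1 by apply: ord1.
  have -> : diff C 0 k 0 = (row k A) 0 0 by rewrite mxE.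
  apply: const; apply/AP; exists (delta_mx 0 k); exact: rowE.
have -> : diff C i.+1 k l' = (row k (sdiff (st i.+1))) 0 l' by rewrite mxE.
by apply: (minst i); apply/exst; exists (delta_mx 0 k); apply: rowE.
Qed.

End Resolution.

(** * Regularity of the Stanley-Reisner ring of a shellable complex *)

Section RegularityFormula.
Variables (K : fieldType) (V : finType) (D : scomplex V).
Local Notation N := #|V|.
Local Notation R := {mpoly K[N]}.

Lemma SR_resolution :
  exists C : free_complex (SR_ring K D), minimal_graded_resolution (@SR_grading K V D) C.
Proof.
apply: (cyclic_resolution (x := srpi D 1)).
- by exists 1 => //; rewrite -mpolyC1; apply: homogeneousC.
- by move=> y; exists (repr y); rewrite srpiZ mulr1 srpi_repr.
- move=> a; rewrite srpiZ mulr1 => /srpi_eq0; apply.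
  rewrite /vface; have -> : mnm_supp 0%MM = set0 :> {set 'I_N}.
    by apply/setP=> i; rewrite !inE mnm0E.
  by rewrite imset0 face0.
- move=> z a; rewrite !srpiZ !mulr1 => /srpi_eq0 h; apply/srpi_eq0.
  exact: vanishes_on_homz.
Qed.

Lemma regularity_rshelling s : @vface V D =1 is_face s -> rshelling s ->
  antichain s -> s != [::] -> reg_SR K D = (max_restriction s)%:Z.
Proof.
move=> sE sh anti s0.
(* [betti] may pick a different resolution for each (i, j), so Koszul homology is used with
   whichever one is picked. *)
have bP i j : exists2 C : free_complex (SR_ring K D),
    minimal_graded_resolution (@SR_grading K V D) C &
    betti (@SR_grading K V D) i j = #|[set k : 'I_(rk C i) | deg k == j]|.
  apply: (@choice_ofP nat 0%N (fun b => exists2 C, minimal_graded_resolution _ C & b = _)).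
  by have [C Cmin] := SR_resolution; exists #|[set k : 'I_(rk C i) | deg k == j]|, C.
have bK i j : exists2 C : free_complex (SR_ring K D),
    minimal_graded_resolution (@SR_grading K V D) C &
    betti (@SR_grading K V D) i j <> 0%N <-> koszul_nonvanishing C 0 i j.
  have [C Cmin bE] := bP i j; exists C => //.
  rewrite -[i in koszul_nonvanishing C 0 i j]addn0 -(koszul_nonvanishing_shift Cmin).
  rewrite (koszul_nonvanishing0 Cmin) bE.
  split=> [/eqP|[k kj]].
    by rewrite -lt0n => /card_gt0P[k]; rewrite inE => /eqP kj; exists k.
  by apply/eqP; rewrite -lt0n; apply/card_gt0P; exists k; rewrite inE kj.
apply: maxzE => [|z [i [j [b0 ->]]]]; last first.
  have [C Cmin bE] := bK i j; apply: (koszul_nonvanishing_facesP Cmin sE sh).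
  exact/bE.
have [p [q [qp qd dq nq]]] := kpoly_face_nonexact K sh anti s0.
exists p, ((max_restriction s)%:Z + p%:Z); rewrite addrK; split=> //.
have [C Cmin bE] := bK p ((max_restriction s)%:Z + p%:Z); apply/bE.
by apply: (koszul_nonvanishing_faces Cmin sE _ qp qd dq nq); rewrite addrK.
Qed.

End RegularityFormula.

(** * Shellings of a complex and of its expansion *)

Lemma rshellingP (V : finType) (s : seq {set V}) :
    (forall s1 F s2, s = s1 ++ F :: s2 -> forall G, G \in s2 ->
       exists2 v, v \in F :\: G & v \in restriction s2 F) ->
  rshelling s.
Proof.
elim: s => //= F s IHs h; split=> [G Gs|]; first exact: (h [::] F s).
by apply: IHs => s1 G s2 sE; apply: (h (F :: s1)); rewrite sE.
Qed.

Section TransportFacetLists.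
Variables (V W : finType) (f : V -> W).
Hypothesis f_inj : injective f.
Implicit Types (F G : {set V}) (s : seq {set V}).
Local Notation fs := (map (fun F => f @: F)).

Lemma imset_setD F G : f @: (F :\: G) = f @: F :\: f @: G.
Proof.
apply/setP=> w; rewrite inE; apply/imsetP/andP => [[v]|[wG /imsetP[v vF wE]]].
  by rewrite inE => /andP[vG vF] ->; rewrite (mem_imset _ _ f_inj) vG imset_f.
by exists v => //; rewrite inE vF andbT; apply: contra wG => vG; rewrite wE imset_f.
Qed.

Lemma restriction_imset s F : restriction (fs s) (f @: F) = f @: restriction s F.
Proof.
have hE v : has (fun H => f @: F :\: H == [set f v]) (fs s) =
            has (fun H => F :\: H == [set v]) s.
  rewrite has_map; apply: eq_has => H /=.
  by rewrite -imset_setD -imset_set1 (inj_eq (imset_inj f_inj)).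
apply/setP=> w; rewrite inE; apply/andP/imsetP => [[/imsetP[v vF ->]]|[v]].
  by rewrite hE => hv; exists v; rewrite // inE vF.
by rewrite inE => /andP[vF hv] ->; rewrite hE imset_f.
Qed.

Lemma rshelling_imset s : rshelling s -> rshelling (fs s).
Proof.
elim: s => //= F s IHs [h /IHs ?]; split=> // _ /mapP[G Gs ->].
have [v vFG vr] := h G Gs; exists (f v); first by rewrite -imset_setD imset_f.
by rewrite restriction_imset imset_f.
Qed.

Lemma max_restriction_imset s : max_restriction (fs s) = max_restriction s.
Proof. by elim: s => //= F s ->; rewrite restriction_imset card_imset. Qed.

End TransportFacetLists.

Section KeyedShelling.
Variables (V : finType) (D : scomplex V) (key : {set V} -> nat).

Lemma facets_antichain : {in facets D &, forall F G : {set V}, F \subset G -> F = G}.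
Proof.
by move=> F G /facets_inP[_ maxF] /facet_face GD FG; rewrite (maxF G).
Qed.

(* A shelling order that may have ties: facets with equal keys must satisfy the
   condition in both orders. *)
Definition keyed_shelling :=
  {in facets D &, forall F G : {set V}, F != G -> (key G <= key F)%N ->
    exists2 v, v \in F :\: G &
      exists H, [/\ H \in facets D, (key H < key F)%N & F :\: H = [set v]]}.

Definition key_restriction (F : {set V}) :=
  [set v in F | [exists H in facets D, (key H < key F)%N && (F :\: H == [set v])]].

Hypothesis keyP : keyed_shelling.

Lemma keyed_rshelling : exists s : seq {set V},
  [/\ s =i facets D, rshelling s &
      max_restriction s = (\max_(F in facets D) #|key_restriction F|)%N].
Proof.
pose le := [rel F G : {set V} | (key F <= key G)%N].
have le_tr : transitive le by move=> F G H; apply: leq_trans.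
have le_tot : total le by move=> F G; apply: leq_total.
pose s := rev (sort le (enum (facets D))).
have sE : s =i facets D by move=> F; rewrite mem_rev mem_sort mem_enum.
have us : uniq s by rewrite rev_uniq sort_uniq enum_uniq.
have ss : pairwise (fun F G : {set V} => le G F) s.
  rewrite -sorted_pairwise; last by move=> F G H /= h1 h2; apply: le_tr h2 h1.
  by rewrite rev_sorted; apply: sort_sorted.
(* Ties do no harm: if F \ H = {v} with equal keys, [keyP] provides an H' of smaller key with the
   same difference. *)
have restrE s1 F s2 : s = s1 ++ F :: s2 -> restriction s2 F = key_restriction F.
  move=> sE'; move: ss us; rewrite sE' pairwise_cat cat_uniq /= => /and4P[/allrelP r1 _ /allP r2 _].
  case/and3P => _ _ /andP[Fs2 _].
  have Fs : F \in s by rewrite sE' mem_cat inE eqxx orbT.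
  have s2s H : H \in s2 -> H \in s by move=> h; rewrite sE' mem_cat inE h !orbT.
  apply/setP=> v; rewrite !inE; case: (boolP (v \in F)) => //= vF.
  apply/hasP/exists_inP => [[H Hs2 /eqP FH]|[H HD /andP[kH FH]]].
    have FnH : F != H by apply: contraNneq Fs2 => ->.
    have [|||v' v'FH [H' [H'D kH' FH']]] := keyP _ _ FnH; rewrite -?sE //.
    - exact: s2s.
    - exact: r2.
    - move: v'FH; rewrite FH inE => /eqP vv'; exists H' => //.
      by rewrite kH' FH' vv' eqxx.
  exists H => //; move: HD; rewrite -sE sE' mem_cat inE => /or3P[Hs1|/eqP HF|//].
    by have := r1 H F Hs1 (mem_head _ _); rewrite /= leqNgt kH.
  by rewrite HF ltnn in kH.
exists s; split=> //.
  apply: rshellingP => s1 F s2 sE' G Gs2; rewrite (restrE _ _ _ sE').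
  move: ss us; rewrite sE' pairwise_cat cat_uniq /= => /and4P[_ _ /allP r2 _].
  case/and3P => _ _ /andP[Fs2 _].
  have FG : F != G by apply: contraNneq Fs2 => ->.
  have [|||v vFG [H [HD kH FH]]] := keyP _ _ FG.
  - by rewrite -sE sE' mem_cat inE eqxx orbT.
  - by rewrite -sE sE' mem_cat inE Gs2 !orbT.
  - exact: r2.
  exists v => //; rewrite inE; move: vFG; rewrite inE => /andP[_ ->] /=.
  by apply/exists_inP; exists H; rewrite // kH FH eqxx.
transitivity (\max_(F <- s) #|key_restriction F|)%N.
  suff h t : (exists s1, s = s1 ++ t) ->
      max_restriction t = (\max_(F <- t) #|key_restriction F|)%N.
    by apply: h; exists [::].
  elim: t => [|F s2 IHs] [s1 sE'] /=; first by rewrite big_nil.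
  rewrite big_cons (restrE _ _ _ sE') IHs //; by exists (rcons s1 F); rewrite cat_rcons.
rewrite -[RHS]big_enum; apply: perm_big; apply: uniq_perm => //; first exact: enum_uniq.
by move=> F; rewrite sE mem_enum.
Qed.

Lemma vface_is_face (s : seq {set V}) : s =i facets D ->
  @vface V D =1 is_face (map (fun F : {set V} => enum_rank @: F) s).
Proof.
move=> sE T; rewrite /vface; apply/idP/hasP => [/sub_facet[F FD TF]|[_ /mapP[F Fs ->] TF]].
  exists (enum_rank @: F); first by apply: map_f; rewrite sE.
  by rewrite -[T](enum_val_setK T); apply: imsetS.
have FD : F \in faces D by apply: facet_face; rewrite -sE.
by apply: faceS FD; rewrite -(enum_rank_setK F); apply: imsetS.
Qed.

Lemma reg_SR_keyed (K : fieldType) :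
  reg_SR K D = (\max_(F in facets D) #|key_restriction F|)%N%:Z.
Proof.
have [s [sE sh <-]] := keyed_rshelling.
rewrite -(max_restriction_imset (@enum_rank_inj V)); apply: regularity_rshelling.
- exact: vface_is_face.
- exact/rshelling_imset/sh/enum_rank_inj.
- move=> _ _ /mapP[F Fs ->] /mapP[G Gs ->] FG.
  rewrite !sE in Fs Gs; rewrite (facets_antichain Fs Gs) //.
  by rewrite -(enum_rank_setK F) -(enum_rank_setK G); apply: imsetS.
have [F FD _] := sub_facet (face0 D).
by case: (s) (sE F) => //; rewrite FD.
Qed.

End KeyedShelling.

Lemma shelling_keyed (V : finType) (D : scomplex V) Fs :
  shelling D Fs -> keyed_shelling D (fun F => index F Fs).
Proof.
case=> uFs FsE sh F G FD GD FG.
have iF : (index F Fs < size Fs)%N by rewrite index_mem FsE.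
have iG : (index G Fs < size Fs)%N by rewrite index_mem FsE.
rewrite leq_eqVlt => /orP[/eqP e|GF].
  by case/eqP: FG; rewrite -(nth_index set0 (_ : F \in Fs)) ?FsE // -e nth_index ?FsE.
have [|v [l lF [vFG FH]]] := sh (index G Fs) (index F Fs); first by rewrite GF.
move: vFG FH; rewrite !nth_index ?FsE // => vFG FH.
exists v => //; exists (nth set0 Fs l); have lsz := ltn_trans lF iF.
by split; rewrite ?index_uniq // -FsE mem_nth.
Qed.

(** * Shelling the expansion and its restriction sets *)

Section ExpansionShelling.
Variables (V : finType) (D : scomplex V) (s : V -> nat).
Hypothesis s_gt0 : forall v, (0 < s v)%N.
Variable key : {set V} -> nat.
Local Notation T := {v : V & 'I_(s v)}.
Local Notation E := (expansion D s_gt0).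
Local Notation pt r v := (Tagged (fun v => 'I_(s v)) (r v)).
Implicit Types (r : {dffun forall v : V, 'I_(s v)}) (A : {set V}).

Definition lift_bound := (\sum_v s v).+1.

(* Lexicographic order: the facet of [D] first, then the sum of the copy indices. *)
Definition lift_key (G : {set T}) : nat :=
  (key [set tag w | w in G] * lift_bound + \sum_(w in G) tagged w)%N.

Lemma lift_faceP r A w : reflect (exists2 v, v \in A & w = pt r v) (w \in lift_face r A).
Proof. exact: imsetP. Qed.

Lemma mem_lift_face r A v : (pt r v \in lift_face r A) = (v \in A).
Proof. by apply/lift_faceP/idP => [[u uA /(congr1 tag) /= ->]|vA] //; exists v. Qed.

Lemma tag_lift_face r A : [set tag w | w in lift_face r A] = A.
Proof.
apply/setP=> v; apply/imsetP/idP => [[w /lift_faceP[u uA ->] ->] //|vA].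
by exists (pt r v); rewrite ?mem_lift_face.
Qed.

Lemma card_lift_face r A : #|lift_face r A| = #|A|.
Proof. by apply: card_in_imset => u v _ _ /(congr1 tag). Qed.

Lemma lift_keyE r A : lift_key (lift_face r A) = (key A * lift_bound + \sum_(v in A) r v)%N.
Proof.
rewrite /lift_key tag_lift_face /lift_face big_imset //=.
by move=> u v _ _ /(congr1 tag).
Qed.

Lemma lift_sum_lt r A : (\sum_(v in A) r v < lift_bound)%N.
Proof.
rewrite ltnS big_mkcond leq_sum // => v _; case: ifP => // _.
exact: ltnW.
Qed.

Lemma lift_key_lt r A r' A' : (key A < key A')%N ->
  (lift_key (lift_face r A) < lift_key (lift_face r' A'))%N.
Proof.
move=> kA; rewrite !lift_keyE; have := lift_sum_lt r A.
move: (\sum_(v in A) r v)%N (\sum_(v in A') r' v)%N => x y.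
have := leq_mul2r lift_bound (key A).+1 (key A'); rewrite kA orbT; nia.
Qed.

Lemma mem_facets_expansion r A : A \in facets D -> lift_face r A \in facets E.
Proof. by move=> AD; rewrite facets_expansion; apply/imset2P; exists r A; rewrite ?in_setT. Qed.

Lemma facets_expansionP G : G \in facets E ->
  exists r A, A \in facets D /\ G = lift_face r A.
Proof. by rewrite facets_expansion => /imset2P[r A _ AD ->]; exists r, A. Qed.

Definition lower r (v : V) (k : 'I_(s v)) : {dffun forall v : V, 'I_(s v)} :=
  [ffun u => dfwith (fun u => r u) k u].

Lemma lowerE r v (k : 'I_(s v)) : lower r k v = k.
Proof. by rewrite ffunE dfwith_in. Qed.

Lemma lowerN r v (k : 'I_(s v)) u : u != v -> lower r k u = r u.
Proof. by move=> uv; rewrite ffunE dfwith_out // eq_sym. Qed.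

Lemma lower_setD r A v (k : 'I_(s v)) : v \in A -> k != r v ->
  lift_face r A :\: lift_face (lower r k) A = [set pt r v].
Proof.
move=> vA kr; apply/setP=> w; rewrite !inE; apply/andP/eqP => [[nw /lift_faceP[u uA wE]]|->].
  rewrite wE; have [<- //|uv] := eqVneq u v; case/negP: nw.
  by rewrite wE -(lowerN r k uv) mem_lift_face.
rewrite mem_lift_face; split=> //; apply/lift_faceP => -[u uA e].
have uv : v = u := congr1 tag e; case: u / uv uA e => _ /eqP.
by rewrite eq_Tagged /= lowerE eq_sym (negbTE kr).
Qed.

Lemma lower_key r A v (k : 'I_(s v)) : v \in A -> (k < r v)%N ->
  (lift_key (lift_face (lower r k) A) < lift_key (lift_face r A))%N.
Proof.
move=> vA kr; rewrite !lift_keyE ltn_add2l (bigD1 v) //= [X in (_ < X)%N](bigD1 v) //=.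
rewrite lowerE (eq_bigr (fun u => r u : nat)) ?ltn_add2r // => u /andP[_ uv].
by rewrite lowerN.
Qed.

Lemma lift_setD r A A' : lift_face r A :\: lift_face r A' = lift_face r (A :\: A').
Proof.
apply/setP=> w; rewrite inE; apply/andP/lift_faceP => [[nw /lift_faceP[v vA wE]]|[v]].
  by exists v => //; rewrite inE vA andbT; move: nw; rewrite wE mem_lift_face.
by rewrite inE => /andP[vA' vA] ->; rewrite !mem_lift_face.
Qed.

Lemma max_lift_key_restriction_full : (forall v, 1 < s v)%N ->
  (\max_(F in facets E) #|key_restriction E lift_key F| =
   \max_(A in faces D) #|A|)%N.
Proof.
move=> s1; apply/eqP; rewrite eqn_leq; apply/andP; split; apply/bigmax_leqP => F.
  case/facets_expansionP => r [A [AD ->]]; apply: (@leq_trans #|A|).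
    by rewrite -(card_lift_face r) subset_leq_card //; apply/subsetP=> w; rewrite inE => /andP[].
  by rewrite [leqRHS](bigD1 A) ?facet_face //= leq_maxl.
case/sub_facet => A AD FA; apply: (leq_trans (subset_leq_card FA)).
(* The lift by the last copies: each of its points can be lowered to copy 0, so the restriction set
   is the whole facet. *)
have lt v : ((s v).-1 < s v)%N by rewrite prednK.
pose r : {dffun forall v : V, 'I_(s v)} := [ffun v => Ordinal (lt v)].
have FE := mem_facets_expansion r AD.
rewrite [leqRHS](bigD1 _ FE) /= leq_max; apply/orP; left.
rewrite -(card_lift_face r); apply/subset_leq_card/subsetP => _ /lift_faceP[v vA ->].
have r0 : (Ordinal (s_gt0 v) < r v)%N by rewrite ffunE /= -ltnS prednK.
rewrite inE mem_lift_face vA; apply/exists_inP.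
exists (lift_face (lower r (Ordinal (s_gt0 v))) A); first exact: mem_facets_expansion.
by rewrite lower_key //= lower_setD // -val_eqE /= neq_ltn r0.
Qed.


Hypothesis keyP : keyed_shelling D key.

Lemma expansion_keyed : keyed_shelling E lift_key.
Proof.
move=> F G /facets_expansionP[r [A [AD ->]]] /facets_expansionP[r' [A' [A'D ->]]] FG kle.
(* Over distinct facets of [D] the shelling of [D] is lifted with the copies [r] unchanged. *)
have [AA'|AA'] := eqVneq A A'; last first.
  have kA : (key A' <= key A)%N.
    by rewrite leqNgt; apply: contraL kle => /lift_key_lt; rewrite -ltnNge.
  have [v vAA' [H [HD kH AH]]] := keyP AD A'D AA' kA.
  move: vAA'; rewrite inE => /andP[vA' vA]; exists (pt r v).
    rewrite inE mem_lift_face vA andbT.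
    by apply: contra vA' => /lift_faceP[u uA' /(congr1 tag) /= ->].
  exists (lift_face r H); split; first exact: mem_facets_expansion.
    exact: lift_key_lt.
  by rewrite lift_setD AH; apply: imset_set1.
rewrite -AA' in FG kle.
(* Over the same facet, distinct lifts with the index sum of [r'] at most that of [r] must satisfy
   r' v < r v somewhere; lowering [v] to the copy [r' v] gives the required facet. *)
have [v /andP[vA kv]] : exists v, (v \in A) && (r' v < r v)%N.
  apply/existsP; apply: contraNT FG => /existsPn nv; apply/eqP.
  have le v : v \in A -> (r v <= r' v)%N by move=> vA; have := nv v; rewrite vA -leqNgt.
  apply: eq_in_imset => v vA; congr Tagged; apply: val_inj; apply/eqP => /=.
  rewrite eqn_leq le //= leqNgt; apply: contraL kle => lt.
  rewrite !lift_keyE leq_add2l -ltnNge (bigD1 v) //= [X in (_ < X)%N](bigD1 v) //=.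
  by rewrite -addSn leq_add // leq_sum // => u /andP[uA _]; apply: le.
exists (pt r v).
  rewrite inE mem_lift_face vA andbT; apply/lift_faceP => -[u uA e].
  have uv : v = u := congr1 tag e; case: u / uv uA e => _ /eqP.
  by rewrite eq_Tagged /= => /eqP e; rewrite e ltnn in kv.
exists (lift_face (lower r (r' v)) A); split; first exact: mem_facets_expansion.
  exact: lower_key.
by apply: lower_setD => //; rewrite -val_eqE neq_ltn kv.
Qed.

(** Let H witness that the point over v is in the restriction set. If H lies over [A], then v has
    two copies. Otherwise the vertex that the shelling of [D] gives for [A] and the facet under H
    can only be v. *)
Lemma lift_key_restriction r A : A \in facets D ->
  (#|key_restriction E lift_key (lift_face r A)| <=
     #|key_restriction D key A| + #|[set v in A | (1 < s v)%N]|)%N.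
Proof.
move=> AD; have [cU _] := leq_card_setU (key_restriction D key A) [set v in A | (1 < s v)%N].
apply: leq_trans cU; rewrite -(card_lift_face r); apply/subset_leq_card/subsetP => w.
rewrite inE => /andP[/lift_faceP[v vA wE] /exists_inP[_ /facets_expansionP[r' [A' [A'D ->]]]]].
rewrite {w}wE mem_lift_face inE => /andP[kH /eqP FH]; apply/orP.
have [AA'|AA'] := eqVneq A A'.
  right; rewrite inE vA /=; rewrite -AA' in FH.
  have vr : r' v != r v.
    have : pt r v \in [set pt r v] by rewrite inE.
    by rewrite -FH inE => /andP[+ _]; apply: contraNneq => <-; rewrite mem_lift_face.
  rewrite ltnNge; apply: contra vr => s1; apply/eqP/val_inj => /=.
  have : (r v < 1)%N /\ (r' v < 1)%N by split; apply: leq_trans s1.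
  by case; rewrite !ltnS !leqn0 => /eqP-> /eqP->.
have kA : (key A' <= key A)%N.
  by rewrite leqNgt; apply: contraL (ltnW kH) => /lift_key_lt; rewrite -ltnNge.
have [u uAA' [H [HD kHA AH]]] := keyP AD A'D AA' kA.
left; rewrite inE vA; apply/exists_inP; exists H; rewrite // kHA AH.
have : pt r u \in [set pt r v].
  move: uAA'; rewrite -FH !inE mem_lift_face => /andP[uA' ->]; rewrite andbT.
  by apply: contra uA' => /lift_faceP[x xA' /(congr1 tag) /= ->].
by rewrite inE => /eqP /(congr1 tag) /= ->; rewrite eqxx.
Qed.

Lemma max_lift_key_restriction :
  (\max_(F in facets E) #|key_restriction E lift_key F| <=
   \max_(A in facets D) #|key_restriction D key A| +
   \max_(A in facets D) #|[set v in A | (1 < s v)%N]|)%N.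
Proof.
apply/bigmax_leqP => F /facets_expansionP[r [A [AD ->]]].
apply: leq_trans (lift_key_restriction r AD) _; apply: leq_add.
  by rewrite (bigD1 A) //= leq_maxl.
by rewrite [leqRHS](bigD1 A) //= leq_maxl.
Qed.

End ExpansionShelling.

(** * Krull dimension *)

Section KillVariables.
Variables (K : fieldType) (N : nat) (W : {set 'I_N}).
Local Notation R := {mpoly K[N]}.
Implicit Types (p q : R) (m : 'X_{1..N}).

(** The retraction of R onto the polynomial ring in the variables of [W]. *)
Definition kill p : R := p \mPo [tuple if i \in W then 'X_i else 0 | i < N].

Lemma killM p q : kill (p * q) = kill p * kill q.
Proof. exact: rmorphM. Qed.

Lemma kill_prod (I : Type) (r : seq I) (P : pred I) (f : I -> R) :
  kill (\prod_(i <- r | P i) f i) = \prod_(i <- r | P i) kill (f i).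
Proof. exact: rmorph_prod. Qed.

Lemma killX n p : kill (p ^+ n) = kill p ^+ n.
Proof. exact: rmorphXn. Qed.

Lemma kill_monomial m : kill 'X_[m] = if mnm_supp m \subset W then 'X_[m] else 0.
Proof.
rewrite /kill comp_mpolyX; case: ifPn => [mW|/subsetPn[i]].
  rewrite [RHS]mpolyXE_id; apply: eq_bigr => i _; rewrite tnth_mktuple.
  case: (boolP (i \in W)) => // /(contra (subsetP mW i)).
  by rewrite inE -eqn0Ngt => /eqP ->; rewrite !expr0.
rewrite inE => mi iW; rewrite (bigD1 i) //= tnth_mktuple (negbTE iW).
by rewrite expr0n eqn0Ngt mi mul0r.
Qed.

Lemma mcoeff_kill p m : (kill p)@_m = if mnm_supp m \subset W then p@_m else 0.
Proof.
rewrite [p in kill p]mpolyE /kill rmorph_sum /= raddf_sum /=.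
have kE k : (p@_k *: 'X_[k] \mPo [tuple if i \in W then 'X_i else 0 | i < N])@_m =
    if (k == m) && (mnm_supp m \subset W) then p@_m else 0.
  rewrite comp_mpolyZ mcoeffZ -/(kill _) kill_monomial.
  have [->|km] := eqVneq k m.
    by case: ifP => _; rewrite ?mcoeffX ?eqxx ?mulr1 // mcoeff0 mulr0.
  by case: ifP => _; rewrite ?mcoeffX ?(negbTE km) ?mcoeff0 mulr0.
under eq_bigr do rewrite kE.
have [mp|mp] := boolP (m \in msupp p); last first.
  by rewrite (memN_msupp_eq0 mp) if_same big1 // => k _; rewrite if_same.
rewrite (bigD1_seq m) ?msupp_uniq //= eqxx big1 ?addr0 // => k /negbTE->.
by [].
Qed.

Lemma kill_eq0 p : kill p = 0 <-> vanishes_on (fun S => S \subset W) p.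
Proof.
split=> [k0 m mW|h]; first by have := mcoeff_kill p m; rewrite mW k0 mcoeff0.
by apply/mpolyP=> m; rewrite mcoeff_kill mcoeff0; case: ifP => // /h.
Qed.

Lemma vanishes_onM_prime p q : vanishes_on (fun S => S \subset W) (p * q) ->
  vanishes_on (fun S => S \subset W) p \/ vanishes_on (fun S => S \subset W) q.
Proof.
move/kill_eq0; rewrite killM => /eqP; rewrite mulf_eq0 => /orP[] /eqP /kill_eq0; by [left|right].
Qed.

End KillVariables.

Section FacePrimes.
Variables (K : fieldType) (V : finType) (D : scomplex V).
Local Notation N := #|V|.
Local Notation R := {mpoly K[N]}.
Variable W : {set 'I_N}.
Hypothesis WD : vface D W.
Local Notation vanishW := (vanishes_on (fun S => S \subset W)).

(** The prime generated by the variables outside [W], tested on a representative; as [W] is a face,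
    the choice does not matter. *)
Definition face_prime : {pred SR_ring K D} := fun x => `[< vanishW (repr x) >].

Lemma face_primeE (p : R) : (srpi D p \in face_prime) = `[< vanishW p >].
Proof.
have eq_vanish (q q' : R) : srpi D q = srpi D q' -> vanishW q -> vanishW q'.
  move=> e hq m mW; have /srpi_eq0 h : srpi D (q - q') = 0 by rewrite srpiB e subrr.
  by have := h m (vfaceS mW WD); rewrite mcoeffB hq // sub0r => /eqP; rewrite oppr_eq0 => /eqP.
by apply/asboolP/asboolP; apply: eq_vanish; rewrite srpi_repr.
Qed.

Fact face_prime_idealr : idealr_closed face_prime.
Proof.
have e (x : SR_ring K D) : x = srpi D (repr x) by rewrite srpi_repr.
split.
- have -> : 0 = srpi D (0 : R) by apply/esym/srpi_eq0 => m _; rewrite mcoeff0.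
  by rewrite face_primeE; apply/asboolP => m _; rewrite mcoeff0.
- rewrite -(srpi1 K D) face_primeE; apply/asboolP => /(_ 0%MM).
  rewrite mcoeff1 eqxx => h; suff /h/eqP : mnm_supp 0%MM \subset W by rewrite oner_eq0.
  by apply/subsetP=> i; rewrite inE mnm0E.
- move=> a u v; rewrite (e u) (e v) (e a) -srpiM -srpiD !face_primeE.
  move=> /asboolP hu /asboolP hv; apply/asboolP => m mW.
  rewrite mcoeffD hv // addr0; apply: (@vanishes_onM K N (fun S => S \subset W)) => //.
  by move=> S T ST; apply: subset_trans.
Qed.

Fact face_prime_prime : prime_idealr_closed face_prime.
Proof.
move=> u v; rewrite -[u]srpi_repr -[v]srpi_repr -srpiM !face_primeE.
by move=> /asboolP/vanishes_onM_prime[] h; apply/orP; [left|right]; apply/asboolP.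
Qed.

HB.instance Definition _ := isIdealr.Build (SR_ring K D) face_prime face_prime_idealr.
HB.instance Definition _ := isPrimeIdealrClosed.Build (SR_ring K D) face_prime face_prime_prime.

Definition face_prime_ideal : prime_idealr (SR_ring K D) := face_prime.

End FacePrimes.

Section KrullDimension.
Variables (K : fieldType) (V : finType) (D : scomplex V).
Local Notation N := #|V|.
Local Notation R := {mpoly K[N]}.

Lemma face_prime_chain (F : {set V}) : F \in faces D -> prime_chain (SR_ring K D) #|F|.
Proof.
(* Dropping the vertices of [F] one at a time enlarges the prime by one variable at each step. *)
move=> FD; pose W i := [set j in rank_set F | (i <= index j (enum (rank_set F)))%N].
have WD i : vface D (W i).
  rewrite /vface; apply: faceS FD; rewrite -(enum_rank_setK F).
  by apply: imsetS; apply/subsetP=> j; rewrite inE => /andP[].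
exists (fun i => face_prime_ideal K (WD i)) => i j ij; split=> [x|sub].
  rewrite -[x]srpi_repr !(face_primeE (WD _)) => /asboolP h; apply/asboolP => m mW.
  apply: h; apply: subset_trans mW _; apply/subsetP=> k; rewrite !inE => /andP[-> /=].
  exact/leq_trans/ltnW.
have cF : #|rank_set F| = #|F| by rewrite card_imset //; apply: enum_rank_inj.
have iF : (i < #|rank_set F|)%N by rewrite cF; apply: leq_trans ij _; rewrite -ltnS.
pose k := enum_val (Ordinal iF).
have ik : index k (enum (rank_set F)) = i.
  rewrite /k (enum_val_nth (enum_val (Ordinal iF))) index_uniq ?enum_uniq // -cardE //.
have kF : k \in rank_set F := enum_valP _.
have : srpi D ('X_k : R) \in face_prime_ideal K (WD i).
  apply: sub; rewrite (face_primeE (WD _)); apply/asboolP => m mW.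
  rewrite mcoeffX; case: eqP => // e; move/subsetP/(_ k): mW.
  by rewrite -e !inE mnm1E eqxx ik [(j <= i)%N]leqNgt ij andbF => /(_ isT).
rewrite (face_primeE (WD _)) => /asboolP/(_ U_(k)%MM).
rewrite mcoeffX eqxx => h; suff /h/eqP : mnm_supp U_(k)%MM \subset W i by rewrite oner_eq0.
by apply/subsetP=> l; rewrite !inE mnm1E; case: eqVneq => // <-; rewrite kF ik leqnn.
Qed.

End KrullDimension.

(* Peeling off one variable at a time: divide by the largest power of [y k]
   (allowed as [y k] is not in the prime [P k]), then drop the multiples of
   [y k] (which lie in [P k.+1]). *)
Lemma prime_chain_no_relation (A : comNzRingType) n t (P : nat -> prime_idealr A)
    (y : 'I_n -> A) (c : {ffun 'I_n -> 'I_t} -> A) :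
    (forall k, (k < n)%N -> {subset P k <= P k.+1}) ->
    (forall i : 'I_n, y i \in P i.+1 /\ y i \notin P i) ->
    (forall a, c a = 0 \/ c a \notin P n) ->
    \sum_a c a * \prod_i y i ^+ a i \in P 0%N ->
  forall a, c a = 0.
Proof.
move=> PS yP cP rel a0; apply/eqP/negPn/negP => ca0.
have claim k : (k <= n)%N -> exists B : {set {ffun 'I_n -> 'I_t}},
    [/\ B != set0, forall a, a \in B -> c a != 0,
        forall a b, a \in B -> b \in B -> forall i : 'I_n, (i < k)%N -> a i = b i &
        \sum_(a in B) c a * \prod_(i < n | (k <= i)%N) y i ^+ a i \in P k].
  elim: k => [|k IHk] kn.
    exists [set a | c a != 0]; split=> [|a|//|]; last 1 first.
      move: rel; rewrite (bigID (fun a => c a != 0)) /= [X in _ + X]big1 ?addr0; last first.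
        by move=> a /negPn/eqP ->; rewrite mul0r.
      by congr (_ \in P 0%N); apply: eq_bigl => a; rewrite inE.
      by apply/set0Pn; exists a0; rewrite inE.
    by rewrite inE.
  have [B [/set0Pn[b0 b0B] cB eqB sB]] := IHk (ltnW kn).
  pose ik := Ordinal kn; have [yS yN] := yP ik.
  have [b bB bmin] := @arg_minnP _ b0 (fun a => a \in B) (fun a => a ik : nat) b0B.
  exists [set a in B | a ik == b ik]; split=> [|a|a a'|].
  - by apply/set0Pn; exists b; rewrite inE bB eqxx.
  - by rewrite inE => /andP[/cB].
  - rewrite !inE => /andP[aB /eqP ab] /andP[a'B /eqP a'b] i.
    rewrite ltnS leq_eqVlt => /orP[/eqP ik'|]; last exact: eqB.
    by have -> : i = ik by [apply: val_inj]; rewrite ab a'b.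
  pose rest (a : {ffun 'I_n -> 'I_t}) := \prod_(i < n | (k < i)%N) y i ^+ a i.
  have prodE (a : {ffun 'I_n -> 'I_t}) :
      \prod_(i < n | (k <= i)%N) y i ^+ a i = y ik ^+ a ik * rest a.
    rewrite (bigD1 ik) //=; congr (_ * _); apply: eq_bigl => i.
    by rewrite -val_eqE /= ltn_neqAle eq_sym andbC.
  have sB' : \sum_(a in B) c a * (y ik ^+ (a ik - b ik) * rest a) \in P k.
    have : y ik ^+ b ik * \sum_(a in B) c a * (y ik ^+ (a ik - b ik) * rest a) \in P k.
      rewrite mulr_sumr; move: sB; congr (_ \in P k); apply: eq_bigr => a aB.
      by rewrite prodE [RHS]mulrCA; congr (_ * _); rewrite [RHS]mulrA -exprD subnKC ?bmin.
    rewrite prime_idealrM => /orP[|//]; suff /negbTE -> : y ik ^+ b ik \notin P k by [].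
    elim: (b ik : nat) => [|e IHe]; first by rewrite expr0 idealr1.
    by rewrite exprS prime_idealrM negb_or yN.
  have := PS k kn _ sB'; rewrite (bigID (fun a : {ffun 'I_n -> 'I_t} => a ik == b ik)) /=.
  rewrite rpredDr.
    congr (_ \in P k.+1); apply: eq_big => [a|a /andP[_ /eqP ->]]; first by rewrite inE.
    by rewrite subnn expr0 mul1r.
  apply: rpred_sum => a /andP[aB ab].
  have : (b ik < a ik)%N.
    rewrite ltn_neqAle bmin // andbT; apply: contra ab => /eqP e.
    by apply/eqP/val_inj/esym.
  rewrite -subn_gt0 => /prednK <-; apply: idealMr; rewrite mulrC; apply: idealMr.
  by rewrite exprSr; apply: idealMr.
(* At k = n all exponents in [B] agree, so a single nonzero coefficient remains and lies in
   [P n]. *)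
have [B [/set0Pn[b bB] cB eqB sB]] := claim n (leqnn n).
move: sB; rewrite (_ : B = [set b]); last first.
  apply/setP=> a; rewrite inE; apply/idP/eqP => [aB|->//].
  by apply/ffunP=> i; apply: eqB.
rewrite big_set1 big_pred0 ?mulr1; last by move=> i; rewrite leqNgt ltn_ord.
by have := cB b bB; case: (cP b) => [->|/negbTE->]//; rewrite eqxx.
Qed.

Section AlgebraicDependence.
Variables (K : fieldType) (N : nat) (W : {set 'I_N}).
Local Notation R := {mpoly K[N]}.

Lemma mdeg_prod_le (I : Type) (r : seq I) (f : I -> R) e :
    (forall i m, m \in msupp (f i) -> (mdeg m <= e)%N) ->
  forall m, m \in msupp (\prod_(i <- r) f i) -> (mdeg m <= size r * e)%N.
Proof.
move=> fe; elim: r => [|i r IHr] m.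
  by rewrite big_nil msupp1 inE => /eqP ->; rewrite mdeg0.
rewrite big_cons => /msuppM_le/allpairsP[[m1 m2] /= [m1i m2r ->]].
by rewrite mdegD mulSn leq_add ?IHr // (fe i).
Qed.

Lemma mdeg_exp_le (p : R) e n : (forall m, m \in msupp p -> (mdeg m <= e)%N) ->
  forall m, m \in msupp (p ^+ n) -> (mdeg m <= n * e)%N.
Proof.
move=> pe m; rewrite -[n]subn0 -prodr_const_nat => /(@mdeg_prod_le _ _ (fun=> p)).
by rewrite size_iota subn0; apply=> _; apply: pe.
Qed.

(* Count monomials: there are [t ^ n] products [q^a] but only about
   [(n e t) ^ #|W|] monomials that can occur in them. *)
Lemma algebraic_dependence n (q : 'I_n -> R) :
    (#|W| < n)%N -> (forall i, kill W (q i) = q i) ->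
  exists t (c : {ffun 'I_n -> 'I_t} -> K), (exists a, c a != 0) /\
    \sum_a c a *: \prod_i q i ^+ a i = 0.
Proof.
move=> Wn kq; pose e := (\max_i msize (q i))%N.
have qe i m : m \in msupp (q i) -> (mdeg m <= e)%N.
  move=> /msize_mdeg_lt/ltnW/leq_trans; apply.
  exact: (@leq_bigmax _ (fun i => msize (q i))).
(* [b] bounds the degrees of the products, and [t] is chosen so that (b + 1) ^ |W| <= t ^ |W| * (n e
   + 1) ^ |W| < t ^ (|W| + 1) <= t ^ n. *)
pose t := ((n * e).+1 ^ #|W|).+1; pose b := (t * (n * e))%N.
pose prd (a : {ffun 'I_n -> 'I_t}) := \prod_i q i ^+ a i.
have prd_deg a m : m \in msupp (prd a) -> (mdeg m <= b)%N.
  move=> /(@mdeg_prod_le _ _ (fun i => q i ^+ a i) (t * e)) h.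
  apply: leq_trans (h _) _; last by rewrite /b mulnCA [index_enum _]unlock -enumT size_enum_ord.
  move=> i k /(mdeg_exp_le (qe i))/leq_trans; apply.
  by rewrite leq_mul2r ltnW ?orbT.
have kprd a : kill W (prd a) = prd a.
  by rewrite kill_prod; apply: eq_bigr => i _; rewrite killX kq.
pose mon (f : {ffun {i | i \in W} -> 'I_b.+1}) : 'X_{1..N} :=
  [multinom (if insub i is Some x then f x : nat else 0%N) | i < N].
pose A := \matrix_(a < #|{ffun 'I_n -> 'I_t}|, f < #|{ffun {i | i \in W} -> 'I_b.+1}|)
  (prd (enum_val a))@_(mon (enum_val f)).
have card_lt : (#|{ffun {i | i \in W} -> 'I_b.+1}| < #|{ffun 'I_n -> 'I_t}|)%N.
  rewrite !card_ffun !card_ord card_sig.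
  have bt : (b.+1 <= t * (n * e).+1)%N by rewrite mulnS -[X in (X <= _)%N]add1n leq_add2r.
  apply: (@leq_ltn_trans ((t * (n * e).+1) ^ #|W|)).
    by case: (posnP #|W|) => [->|W0]; rewrite ?expn0 ?leq_exp2r.
  apply: (@leq_trans (t ^ #|W|.+1)); last by rewrite leq_pexp2l.
  by rewrite expnMn expnSr ltn_pmul2l ?expn_gt0.
have /rowV0Pn[u uA u0] : kermx A != 0.
  rewrite -mxrank_eq0 mxrank_ker -lt0n subn_gt0.
  exact: leq_ltn_trans (rank_leq_col A) card_lt.
exists t, (fun a => u 0 (enum_rank a)); split.
  have /rV0Pn[r ur] := u0; by exists (enum_val r); rewrite enum_valK.
apply/mpolyP=> m; rewrite mcoeff0 raddf_sum /=.
have [mW|mW] := boolP (mnm_supp m \subset W); last first.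
  rewrite big1 // => a _; rewrite mcoeffZ -/(prd a) -kprd mcoeff_kill (negbTE mW).
  by rewrite mulr0.
have [mb|mb] := leqP (mdeg m) b; last first.
  rewrite big1 // => a _; rewrite mcoeffZ -/(prd a) memN_msupp_eq0 ?mulr0 //.
  by apply: contraL mb => /prd_deg; rewrite -leqNgt.
pose f : {ffun {i | i \in W} -> 'I_b.+1} := [ffun x => inord (m (val x))].
have monf : mon f = m.
  apply/mnmP=> i; rewrite mnmE; case: insubP => [x iW <-|iW].
    by rewrite ffunE inordK // ltnS (leq_trans _ mb) // mdegE (bigD1 (val x)) //= leq_addr.
  by move: (contra (subsetP mW i) iW); rewrite inE -eqn0Ngt => /eqP.
move/sub_kermxP: uA => /rowP/(_ (enum_rank f)); rewrite !mxE; apply: etrans.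
rewrite (reindex (@enum_val {ffun 'I_n -> 'I_t} predT)) /=; last exact: onW_bij (enum_val_bij _).
by apply: eq_bigr => r _; rewrite mcoeffZ mxE enum_valK enum_rankK monf.
Qed.

End AlgebraicDependence.

Section KrullDimension.
Variables (K : fieldType) (V : finType) (D : scomplex V).
Local Notation N := #|V|.
Local Notation R := {mpoly K[N]}.

Section OnePrime.
Variable P : prime_idealr (SR_ring K D).
Definition nonvanishing_vars : {set 'I_N} := [set i | srpi D ('X_i : R) \notin P].

Lemma prime_monomial m :
  (srpi D ('X_[m] : R) \in P) = ~~ (mnm_supp m \subset nonvanishing_vars).
Proof.
rewrite mpolyXE_id srpi_prod; under eq_bigr do rewrite srpiX.
apply/idP/subsetPn => [|[i]].
  elim/big_ind: _ => [|x y hx hy|i _]; first by rewrite idealr1.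
    by rewrite prime_idealrM => /orP[/hx|/hy].
  case mi: (m i) => [|k]; first by rewrite expr0 idealr1.
  move=> xP; exists i; rewrite !inE ?mi // negbK; move: xP.
  by elim: k {mi} => [|k IHk]; rewrite ?expr1 // exprS prime_idealrM => /orP[].
rewrite !inE negbK => mi xP; rewrite (bigD1 i) //= -(prednK mi) exprS.
by rewrite mulrC; apply: idealMr; rewrite mulrC; apply: idealMr.
Qed.

(** The product of the variables outside [P] is not in [P], hence is nonzero in K[D]. *)
Lemma vface_nonvanishing_vars : vface D nonvanishing_vars.
Proof.
apply/negPn/negP => nf; have : srpi D ('X_[mesym1 nonvanishing_vars] : R) \in P.
  have -> : srpi D ('X_[mesym1 nonvanishing_vars] : R) = 0.
    apply/srpi_eq0 => m fm; rewrite mcoeffX; case: eqP => // e.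
    by move: nf; rewrite -e mnm_supp_set in fm; rewrite fm.
  exact: rpred0.
by rewrite prime_monomial mnm_supp_set subxx.
Qed.

Lemma kill_mod_prime (p : R) : srpi D (p - kill nonvanishing_vars p) \in P.
Proof.
rewrite [X in srpi D X]mpolyE srpi_sum big_seq rpred_sum // => m.
rewrite mcoeff_msupp mcoeffB mcoeff_kill; case: ifPn => mW; first by rewrite subrr eqxx.
by move=> _; rewrite -mul_mpolyC srpiM; apply: idealMr; rewrite prime_monomial.
Qed.

End OnePrime.

Lemma srpi_const_notin (P : prime_idealr (SR_ring K D)) (c : K) :
  c != 0 -> srpi D c%:MP \notin P.
Proof.
move=> c0; apply/negP => cP; have := idealMr (srpi D (c^-1)%:MP) cP.
by rewrite -srpiM -mpolyCM mulVf // mpolyC1 srpi1 idealr1.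
Qed.

Lemma prime_chain_le d : prime_chain (SR_ring K D) d ->
  exists2 F, F \in faces D & (d <= #|F|)%N.
Proof.
case=> P chain; pose P' k := P (inord k).
have PS k l : (k <= l)%N -> (l <= d)%N -> {subset P' k <= P' l}.
  rewrite leq_eqVlt => /orP[/eqP ->|kl] ld; first by [].
  have [] := chain (inord k) (inord l).
    by rewrite !inordK ?ltnS // (leq_trans (ltnW kl)).
  by [].
pose W := nonvanishing_vars (P' 0%N).
exists [set enum_val i | i in W]; first exact: vface_nonvanishing_vars.
rewrite card_imset; last exact: enum_val_inj.
rewrite leqNgt; apply/negP => Wd.
have /choice[y yP] (i : 'I_#|W|.+1) : exists y, y \in P' i.+1 /\ y \notin P' i.
  have id : (i < d)%N by apply: leq_trans (ltn_ord i) Wd.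
  have [|_ nsub] := chain (inord i) (inord i.+1); first by rewrite !inordK // ltnW.
  apply: contrapT => ny; apply: nsub => x xP; apply/negPn/negP => xN.
  by apply: ny; exists x.
(* Killing the variables outside [W] changes [y i] by an element of the smallest prime only, so
   membership in every prime of the chain is preserved. *)
pose q i := kill W (repr (y i)).
have kq i : kill W (q i) = q i.
  by apply/mpolyP=> m; rewrite /q !mcoeff_kill; case: (_ \subset _).
have qP i k : (k <= d)%N -> (srpi D (q i) \in P' k) = (y i \in P' k).
  move=> kd; have h : srpi D (repr (y i) - q i) \in P' k.
    by apply: (PS 0%N) => //; apply: kill_mod_prime.
  by rewrite -[y i in RHS]srpi_repr -[repr (y i)](subrK (q i)) srpiD rpredDl.
have [t [c [[a ca] rel]]] := algebraic_dependence (ltnSn #|W|) kq.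
have c0 : srpi D (c a)%:MP = 0.
  apply: (@prime_chain_no_relation _ _ _ P' (fun i => srpi D (q i))
    (fun a => srpi D (c a)%:MP)).
  - by move=> k kW; apply: PS => //; apply: leq_trans kW Wd.
  - move=> i; have id : (i < d)%N by apply: leq_trans (ltn_ord i) Wd.
    by rewrite !qP // ltnW.
  - move=> b; have [->|cb] := eqVneq (c b) 0; last by right; apply: srpi_const_notin.
    by left; rewrite mpolyC0; apply: rmorph0.
  suff -> : \sum_b srpi D (c b)%:MP * \prod_i srpi D (q i) ^+ b i = 0 by apply: rpred0.
  transitivity (srpi D (0 : R)); last exact: rmorph0.
  rewrite -rel srpi_sum; apply: eq_bigr => b _; rewrite -mul_mpolyC srpiM; congr (_ * _).
  by rewrite srpi_prod; apply: eq_bigr => i _; rewrite srpiX.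
by have := srpi_const_notin (P' 0%N) ca; rewrite c0 rpred0.
Qed.

Lemma krull_dim_SR : krull_dim (SR_ring K D) = (\max_(F in faces D) #|F|)%N%:Z.
Proof.
apply: maxzE => [|_ [d -> /prime_chain_le[F FD dF]]].
  have D0 : (0 < #|faces D|)%N by apply/card_gt0P; exists set0; apply: face0.
  have [F FD ->] := eq_bigmax_cond (fun F : {set V} => #|F|) D0.
  by exists #|F| => //; apply: face_prime_chain.
by rewrite lez_nat (leq_trans dF) // (bigD1 F) //= leq_maxl.
Qed.

End KrullDimension.

Theorem proposition3p4 (n : nat) (D : scomplex 'I_n) (hD : shellable D)
    (s : 'I_n -> nat) (hs : forall l, (0 < s l)%N) (K : fieldType) :
  ((forall l, (1 < s l)%N) ->
     reg_SR K (expansion D hs) = complex_dim D + 1 /\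
     complex_dim D + 1 = krull_dim (SR_ring K D)) /\
  reg_SR K (expansion D hs) <=
    reg_SR K D + (\max_(F in facets D) #|[set l in F | (1 < s l)%N]|)%N%:Z.
Proof.
have [Fs /shelling_keyed keyP] := hD.
rewrite (reg_SR_keyed (expansion_keyed (s_gt0 := hs) keyP)) (reg_SR_keyed keyP).
rewrite /complex_dim subrK krull_dim_SR; split=> [s1|].
  by rewrite max_lift_key_restriction_full.
by rewrite -PoszD lez_nat; apply: max_lift_key_restriction.
Qed.
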